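(* Let $F$ be a strongly symmetric norm on $\mathbb{R}^2$. Then the set of all irrational $\alpha\in\mathbb{R}$ with $\delta_F(\alpha)<1$ (i.e. the set of irrationals for which Minkowski's approximation theorem can be improved) is uncountable and has Lebesgue measure zero.
   Context: A norm $F$ on $\mathbb{R}^2$ is strongly symmetric if $F(x,y)=F(|x|,|y|)$ for all $(x,y)\in\mathbb{R}^2$ and $F(0,\pm1)=F(\pm1,0)=1$. For $t>0$ put $F_t(x,y)=F(t^{-1}x,ty)$. Let $\mathcal{B}=\{P\in\mathbb{R}^2:F(P)<1\}$ and let $\Delta=\Delta_F$ be the minimal area of a parallelogram with one vertex at the origin and the other three vertices on the boundary of $\mathcal{B}$. For irrational $\alpha$, $\delta_F(\alpha)$ denotes the largest real number with the following property: if $c>\delta_F(\alpha)$ then for every sufficiently large real $t$ there exist integers $p,q$ with $q>0$ and $\Delta\,F_t(q,p-\alpha q)^2<c$, while if $c<\delta_F(\alpha)$ there are arbitrarily large $t$ for which no such $p,q$ exist. *)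

(* Defs.v *)
From HB Require Import structures.
From mathcomp Require Import all_boot all_order all_algebra.
From mathcomp Require Import all_classical all_reals all_analysis.
Set Implicit Arguments.
Unset Strict Implicit.
Unset Printing Implicit Defensive.
Import Order.TTheory GRing.Theory Num.Theory.
Import numFieldNormedType.Exports.
Local Open Scope classical_set_scope.
Local Open Scope ring_scope.

Record is_norm (R : realType) (F : R * R -> R) : Prop := IsNorm {
  norm_eq0 : forall P, F P = 0 -> P = 0;
  norm_homog : forall (a : R) P, F (a *: P) = `|a| * F P;
  norm_triangle : forall P Q, F (P + Q) <= F P + F Q }.

Record strongly_symmetric_norm (R : realType) (F : R * R -> R) : Prop :=
  StronglySymmetricNorm {
  ssn_norm : is_norm F;
  ssn_abs : forall x y : R, F (x, y) = F (`|x|, `|y|);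
  ssn_axes : [/\ F (0, 1) = 1, F (0, -1) = 1, F (1, 0) = 1 & F (-1, 0) = 1] }.

Definition scaled_norm (R : realType) (F : R * R -> R) (t : R) : R * R -> R :=
  fun P => F (t^-1 * P.1, t * P.2).

Definition unit_ball (R : realType) (F : R * R -> R) : set (R * R) :=
  [set P | F P < 1].

Definition boundary (T : topologicalType) (A : set T) : set T :=
  closure A `\` interior A.

(* Area of the parallelogram with vertices 0, P, P + Q, Q. *)
Definition parallelogram_area (R : realType) (P Q : R * R) : R :=
  `|P.1 * Q.2 - P.2 * Q.1|.

(* The areas form a nonempty compact set, so the infimum is a minimum. No
   degenerate parallelogram occurs: if P and Q are collinear and on the
   boundary then Q = P or Q = - P, so P + Q is 2P or 0, not on the boundary. *)
Definition Delta (R : realType) (F : R * R -> R) : R :=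
  inf [set a | exists P Q : R * R,
    [/\ boundary (unit_ball F) P, boundary (unit_ball F) Q,
        boundary (unit_ball F) (P + Q) & a = parallelogram_area P Q]].

Definition approximable (R : realType) (F : R * R -> R) (alpha c t : R) : Prop :=
  exists p q : int, 0 < q /\
    Delta F * scaled_norm F t (q%:~R, p%:~R - alpha * q%:~R) ^+ 2 < c.

Definition delta_spec (R : realType) (F : R * R -> R) (alpha d : R) : Prop :=
  (forall c, d < c -> \forall t \near +oo, approximable F alpha c t) /\
  (forall c, c < d ->
     forall T : R, exists2 t : R, T < t & ~ approximable F alpha c t).

(* For a norm F exactly one d satisfies delta_spec F alpha d, so the supremum
   is the largest such d and never takes its default value. *)
Definition delta (R : realType) (F : R * R -> R) (alpha : R) : R :=
  sup [set d | delta_spec F alpha d].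

(* Main.v *)
(** For large t the lattice of the points (q / t, t (p - alpha q)) has covolume 1
    and its points with q = 0 are long, so delta < 1 means that these lattices
    eventually stay away from the critical lattices of the ball {F < 1}.

    Uncountability.  If F(1,1) > 1, sliding P = (1,l)/F(1,l) and Q = -(l,1)/F(l,1)
    until F(P + Q) = 1 gives a boundary parallelogram of area less than 1, so
    Delta < 1; numbers whose partial quotients are all large then have delta < 1,
    because each of their lattices contains a point of norm at most 1 + eta with a
    small eta.
    If F(1,1) = 1, then F is the sup norm and partial quotients bounded by 2 work.

    Measure zero.  Perturb a lattice spanned by a nearly minimal boundary
    parallelogram so that its basis lies in the open quadrants I and IV.  One
    fixed unimodular matrix with positive entries then produces, inside every
    continued fraction cylinder, an interval of proportional length on which
    approximation with constant c < 1 fails at some large t.  The improvable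
    numbers are thus covered by countably many closed porous sets, which are null
    by the Lebesgue density theorem. *)
Require Import Defs.
From HB Require Import structures.
From mathcomp Require Import all_boot all_order all_algebra.
From mathcomp Require Import all_classical all_reals all_analysis.
From mathcomp Require Import measurable_realfun.
From mathcomp Require Import ring lra zify.
Set Implicit Arguments.
Unset Strict Implicit.
Unset Printing Implicit Defensive.
Import Order.TTheory GRing.Theory Num.Theory.
Import numFieldNormedType.Exports.
Local Open Scope classical_set_scope.
Local Open Scope ring_scope.

(** * Strongly symmetric norms and their critical area *)

Section StronglySymmetricNorm.
Variables (R : realType) (F : R * R -> R).
Hypothesis hF : strongly_symmetric_norm F.

Lemma ssnZ (a x y : R) : F (a * x, a * y) = `|a| * F (x, y).
Proof. exact: (norm_homog (ssn_norm hF) a (x, y)). Qed.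

Lemma ssn_triangle (x y x' y' : R) : F (x + x', y + y') <= F (x, y) + F (x', y').
Proof. exact: (norm_triangle (ssn_norm hF) (x, y) (x', y')). Qed.

Lemma ssnNl (x y : R) : F (- x, y) = F (x, y).
Proof. by rewrite (ssn_abs hF (- x)) normrN -(ssn_abs hF). Qed.

Lemma ssnNr (x y : R) : F (x, - y) = F (x, y).
Proof. by rewrite (ssn_abs hF _ (- y)) normrN -(ssn_abs hF). Qed.

Lemma ssn_x0 (x : R) : F (x, 0) = `|x|.
Proof. by have [_ _ e _] := ssn_axes hF; rewrite -[x in LHS]mulr1 -(mulr0 x) ssnZ e mulr1. Qed.

Lemma ssn_0y (y : R) : F (0, y) = `|y|.
Proof. by have [e _ _ _] := ssn_axes hF; rewrite -[y in LHS]mulr1 -(mulr0 y) ssnZ e mulr1. Qed.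

Lemma ssn_le_sum (x y : R) : F (x, y) <= `|x| + `|y|.
Proof. by rewrite -ssn_x0 -ssn_0y -{1}[x]addr0 -{1}[y]add0r ssn_triangle. Qed.

Lemma ssn_ge0 (x y : R) : 0 <= F (x, y).
Proof.
have := ssn_triangle x y (- x) (- y).
by rewrite !subrr ssn_x0 normr0 ssnNl ssnNr; lra.
Qed.

Lemma ssn_triangleB (x y x' y' : R) :
  F (x, y) - F (x', y') <= F (x - x', y - y').
Proof. by have := ssn_triangle (x - x') (y - y') x' y'; rewrite !subrK; lra. Qed.

(* 2 x' (x, y) is the combination (x' + x)(x', y) + (x' - x)(- x', y). *)
Lemma ssn_monol (x x' y : R) : `|x| <= x' -> F (x, y) <= F (x', y).
Proof.
rewrite ler_norml => /andP[x1 x2]; have [x'0|x'0] := leP x' 0.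
  by have -> : x = x' by lra.
have := ssn_triangle ((x' + x) * x') ((x' + x) * y) ((x' - x) * - x') ((x' - x) * y).
rewrite !ssnZ ssnNl -!mulrDl !ger0_norm; [|lra|lra].
have -> : (x' + x) * x' + (x' - x) * - x' = (2 * x') * x by ring.
have -> : x' + x + (x' - x) = 2 * x' by ring.
by rewrite ssnZ ger0_norm ?ler_pM2l//; lra.
Qed.

Lemma ssn_monor (x y y' : R) : `|y| <= y' -> F (x, y) <= F (x, y').
Proof.
rewrite ler_norml => /andP[y1 y2]; have [y'0|y'0] := leP y' 0.
  by have -> : y = y' by lra.
have := ssn_triangle ((y' + y) * x) ((y' + y) * y') ((y' - y) * x) ((y' - y) * - y').
rewrite !ssnZ ssnNr -!mulrDl !ger0_norm; [|lra|lra].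
have -> : (y' + y) * y' + (y' - y) * - y' = (2 * y') * y by ring.
have -> : y' + y + (y' - y) = 2 * y' by ring.
by rewrite ssnZ ger0_norm ?ler_pM2l//; lra.
Qed.

Lemma ssn_mono (x x' y y' : R) : `|x| <= x' -> `|y| <= y' -> F (x, y) <= F (x', y').
Proof. by move=> /ssn_monol hx /ssn_monor hy; apply: le_trans (hx _) (hy _). Qed.

Lemma ssn_ge_normx (x y : R) : `|x| <= F (x, y).
Proof. by rewrite -ssn_x0 [leRHS](ssn_abs hF) ssn_mono// normr0. Qed.

Lemma ssn_ge_normy (x y : R) : `|y| <= F (x, y).
Proof. by rewrite -ssn_0y [leRHS](ssn_abs hF) ssn_mono// normr0. Qed.

Lemma ssn_le_max (x y m : R) : F (1, 1) <= 1 -> `|x| <= m -> `|y| <= m -> F (x, y) <= m.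
Proof.
move=> F1 xm ym; have m0 : 0 <= m by apply: le_trans xm.
apply: le_trans (ssn_mono xm ym) _.
by rewrite -[X in (X, X)](mulr1 m) ssnZ ger0_norm// ler_piMr.
Qed.

(* A strictly positive increment contains a positive multiple of the vector. *)
Lemma ssn_lt_addpos (x y x' y' : R) : 0 < x -> 0 < y -> 0 < x' -> 0 < y' ->
  F (x, y) < F (x + x', y + y').
Proof.
move=> x0 y0 x'0 y'0.
pose e := Num.min (x' / x) (y' / y).
have e0 : 0 < e by rewrite lt_min !divr_gt0.
have Fp : 0 < F (x, y) by apply: lt_le_trans (ssn_ge_normx x y); rewrite normr_gt0 gt_eqF.
apply: (@lt_le_trans _ _ (F ((1 + e) * x, (1 + e) * y))).
  by rewrite ssnZ gtr0_norm; [rewrite ltr_pMl//; lra | lra].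
have ex : e * x <= x' by rewrite -ler_pdivlMr// ge_min lexx.
have ey : e * y <= y' by rewrite -ler_pdivlMr// ge_min lexx orbT.
apply: ssn_mono; rewrite ger0_norm ?mulr_ge0//; try lra.
Qed.

Lemma ssn_continuous : continuous F.
Proof.
move=> [x y]; apply/cvgrPdist_lt => e e0; near=> z.
have zx : `|x - z.1| < e / 2.
  near: z; apply: (@cvgr_dist_lt _ R^o _ _ _ (fun z : R * R => z.1) x).
    exact: (@cvg_fst _ _ (nbhs x) (nbhs y)).
  by rewrite divr_gt0.
have zy : `|y - z.2| < e / 2.
  near: z; apply: (@cvgr_dist_lt _ R^o _ _ _ (fun z : R * R => z.2) y).
    exact: (@cvg_snd _ _ (nbhs x) (nbhs y)).
  by rewrite divr_gt0.
rewrite [z]surjective_pairing; move: (z.1) (z.2) zx zy => z1 z2 zx zy.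
have h1 := ssn_triangleB x y z1 z2; have h2 := ssn_triangleB z1 z2 x y.
have h3 := ssn_le_sum (x - z1) (y - z2).
have h4 := ssn_le_sum (z1 - x) (z2 - y).
rewrite [`|z1 - x|]distrC [`|z2 - y|]distrC in h4.
by rewrite ltr_norml; apply/andP; split; lra.
Unshelve. all: by end_near. Qed.

(** By continuity the ball is open and the set F <= 1 is closed. Conversely a point with F = 1 is
    the limit of its multiples by s < 1, which lie in the ball. *)
Lemma boundary_unit_ballE (P : R * R) : boundary (unit_ball F) P <-> F P = 1.
Proof.
have oB : open (unit_ball F).
  have -> : unit_ball F = F @^-1` [set r | r < 1] by [].
  by apply: open_comp => [? _|]; [exact: ssn_continuous | exact: open_lt].
rewrite /boundary ((interior_id _).1 oB); split.
  move=> [cP /= nP]; apply/eqP; rewrite eq_le [1 <= _]leNgt; apply/andP; split; last exact/negP.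
  have cB : closed (F @^-1` [set r | r <= 1]).
    by apply: closed_comp => [? _|]; [exact: ssn_continuous | exact: closed_le].
  have := closure_subset (_ : unit_ball F `<=` F @^-1` [set r | r <= 1]) cP.
  rewrite closure_id in cB; rewrite -cB; apply.
  by move=> z; rewrite /unit_ball /=; exact: ltW.
case: P => x y FP; split; last by rewrite /unit_ball /= FP ltxx.
move=> B nB.
have g : (fun s : R => (s * x, s * y)) @ (1 : R)^'- --> ((x, y) : R * R).
  apply: cvg_at_left_filter; rewrite -[X in nbhs (X, _)](mul1r x) -[X in nbhs (_, X)](mul1r y).
  by apply: (@cvg_pair _ _ _ _ (nbhs (1 * x)) (nbhs (1 * y)));
    (apply: cvgM; [exact: cvg_id | exact: cvg_cst]).
have [s [Bs /andP[s0 s1]]] : exists s, B (s * x, s * y) /\ 0 < s < 1.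
  apply: (@filter_ex _ (1 : R)^'-); near=> s; split; first by near: s; exact: (g _ nB).
  by apply/andP; split; near: s; [exact: nbhs_left_gt | exact: nbhs_left_lt].
exists (s * x, s * y); split => //.
by rewrite /unit_ball /= ssnZ FP mulr1 gtr0_norm.
Unshelve. all: by end_near. Qed.

(** * Boundary parallelograms and bounds for the critical area *)

Lemma ssn_comp_continuous (u v : R -> R) (x : R) :
  {for x, continuous u} -> {for x, continuous v} ->
  {for x, continuous (fun l => F (u l, v l))}.
Proof.
move=> cu cv; apply: (@cvg_comp _ _ _ (fun l => (u l, v l)) F _ (nbhs (u x, v x))).
  exact: (@cvg_pair _ _ _ _ (nbhs (u x)) (nbhs (v x))).
exact: ssn_continuous.
Qed.

(** The intermediate value theorem applies to [g l] = F(P + Q), because [g 0] = F(1,1) >= 1 and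
    [g 1] = 0. The area is (1 - l^2) / (F(1,l) F(l,1)), and both norms are at least 1. The value l =
    0 forces [g 0] = 1, the case of the sup norm. *)
Lemma ssn_hexagon : exists l : R, exists P Q : R * R,
  [/\ 0 <= l <= 1, F P = 1, F Q = 1, F (P + Q) = 1 &
     parallelogram_area P Q <= 1 - l ^+ 2 /\ (l = 0 -> F (1, 1) = 1)].
Proof.
pose A l := F (1, l); pose B l := F (l, 1).
have A1 l : 1 <= A l by have := ssn_ge_normx 1 l; rewrite normr1.
have B1 l : 1 <= B l by have := ssn_ge_normy l 1; rewrite normr1.
have A0 l : A l != 0 by have := A1 l; apply: contraTneq => ->; rewrite ler10.
have B0 l : B l != 0 by have := B1 l; apply: contraTneq => ->; rewrite ler10.
have cA : continuous A.
  by move=> x; apply: (@ssn_comp_continuous (cst 1) id x) => //; exact: cvg_cst.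
have cB : continuous B.
  by move=> x; apply: (@ssn_comp_continuous id (cst 1) x) => //; exact: cvg_cst.
have cAV : continuous (fun l => (A l)^-1) by move=> x; apply: cvgV => //; exact: cA.
have cBV : continuous (fun l => (B l)^-1) by move=> x; apply: cvgV => //; exact: cB.
pose g l := F ((A l)^-1 - l * (B l)^-1, l * (A l)^-1 - (B l)^-1).
have cg : continuous g.
  move=> x; apply: (@ssn_comp_continuous (fun l => (A l)^-1 - l * (B l)^-1)
    (fun l => l * (A l)^-1 - (B l)^-1) x); apply: cvgB;
    by [exact: cAV | exact: cBV | apply: cvgM; [exact: cvg_id|exact: cAV]
      | apply: cvgM; [exact: cvg_id|exact: cBV]].
have g0 : g 0 = F (1, 1).
  by rewrite /g /A /B !mul0r subr0 sub0r ssnNr ssn_x0 ssn_0y normr1 invr1.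
have g1 : g 1 = 0 by rewrite /g /A /B !mul1r subrr ssn_x0 normr0.
have F11 : 1 <= F (1, 1) := A1 1.
have [|l l01 gl] := @IVT R g 0 1 1 ler01 (continuous_subspaceT cg).
  by rewrite g0 g1 ge_min le_max F11 ler01 orbT.
exists l, ((A l)^-1 * 1, (A l)^-1 * l), ((- (B l)^-1) * l, (- (B l)^-1) * 1).
move: l01; rewrite in_itv /= => l01; split => //.
- by rewrite ssnZ ger0_norm ?invr_ge0 ?ssn_ge0// mulVf.
- by rewrite ssnZ normrN ger0_norm ?invr_ge0 ?ssn_ge0// mulVf.
- rewrite -[RHS]gl /g; congr (F (_, _)) => /=; ring.
split; last by move=> l0; rewrite -g0 -[RHS]gl l0.
case/andP: l01 => l0 l1.
rewrite /parallelogram_area /=.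
have -> : (A l)^-1 * 1 * (- (B l)^-1 * 1) - (A l)^-1 * l * (- (B l)^-1 * l) =
   - ((1 - l ^+ 2) * ((A l)^-1 * (B l)^-1)) by ring.
have l2 : 0 <= 1 - l ^+ 2 by rewrite subr_ge0 expr_le1.
have AB0 : 0 <= (A l)^-1 * (B l)^-1 by rewrite mulr_ge0 ?invr_ge0 ?ssn_ge0.
rewrite normrN (ger0_norm (mulr_ge0 l2 AB0)) ler_piMr//.
by rewrite mulr_ile1 ?invr_ge0 ?ssn_ge0// invf_le1// ?(lt_le_trans ltr01).
Qed.

Let areas := [set a | exists P Q : R * R,
    [/\ boundary (unit_ball F) P, boundary (unit_ball F) Q,
        boundary (unit_ball F) (P + Q) & a = parallelogram_area P Q]].

(** Every Q - kP has norm at least 1/2: comparing Q with kP, and P + Q with (1 + k)P, bounds it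
    below by the distances of |k| and of |1 + k| from 1, which are not both less than 1/2. Some
    coordinate of P is at least 1/2 in absolute value; choosing k so that this coordinate of Q - kP
    vanishes leaves the determinant divided by it. *)
Lemma parallelogram_area_ge (P Q : R * R) :
  F P = 1 -> F Q = 1 -> F (P + Q) = 1 -> 1 / 4 <= parallelogram_area P Q.
Proof.
case: P Q => [a b] [c d]; rewrite /parallelogram_area /= => FP FQ FS.
have {}FS : F (a + c, b + d) = 1 := FS.
have far k : 1 / 2 <= F (c - k * a, d - k * b).
  have h1 := ssn_triangleB c d (k * a) (k * b).
  have h2 := ssn_triangleB (k * a) (k * b) c d.
  have h3 := ssn_triangleB (a + c) (b + d) ((1 + k) * a) ((1 + k) * b).
  have h4 := ssn_triangleB ((1 + k) * a) ((1 + k) * b) (a + c) (b + d).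
  have e x y : x - y = - (y - x) :> R by ring.
  rewrite [k * a - c]e [k * b - d]e ssnNl ssnNr in h2.
  rewrite [_ * a - _]e [_ * b - _]e ssnNl ssnNr in h4.
  have ex : a + c - (1 + k) * a = c - k * a by ring.
  have ey : b + d - (1 + k) * b = d - k * b by ring.
  rewrite ex ey in h3 h4; rewrite !ssnZ FP in h1 h2 h3 h4.
  rewrite FQ in h1 h2; rewrite FS in h3 h4.
  move: h1 h2 h3 h4; case: (ger0P k) => ?; case: (ger0P (1 + k)) => ?; lra.
have := ssn_le_sum a b; rewrite FP => ab.
have [a2|a2] := leP (1 / 2) `|a|.
  have a0 : a != 0 by apply: contraTneq a2 => ->; rewrite normr0; lra.
  have := far (c / a); rewrite divfK// subrr ssn_0y.
  have -> : d - c / a * b = (a * d - b * c) / a by field.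
  rewrite normrM normfV ler_pdivlMr ?normr_gt0//; lra.
have b0 : b != 0 by apply: contraTneq ab => ->; rewrite normr0; lra.
have := far (d / b); rewrite divfK// subrr ssn_x0.
have -> : c - d / b * a = - ((a * d - b * c) / b) by field.
rewrite normrN normrM normfV ler_pdivlMr ?normr_gt0//; lra.
Qed.

Lemma areas_has_inf : has_inf areas.
Proof.
split.
  have [l [P [Q [_ hP hQ hS _]]]] := ssn_hexagon.
  by exists (parallelogram_area P Q), P, Q; split=> //; apply/boundary_unit_ballE.
exists (1 / 4) => a [P [Q [hP hQ hS ->]]].
by apply: parallelogram_area_ge; exact/boundary_unit_ballE.
Qed.

Lemma Delta_ge : 1 / 4 <= Delta F.
Proof.
apply: lb_le_inf; first by case: areas_has_inf.
move=> a [P [Q [hP hQ hS ->]]].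
by apply: parallelogram_area_ge; exact/boundary_unit_ballE.
Qed.

Lemma Delta_gt0 : 0 < Delta F.
Proof. by apply: lt_le_trans Delta_ge; lra. Qed.

Lemma Delta_le (P Q : R * R) :
  F P = 1 -> F Q = 1 -> F (P + Q) = 1 -> Delta F <= parallelogram_area P Q.
Proof.
move=> hP hQ hS; apply: ge_inf; first by case: areas_has_inf.
by exists P, Q; split=> //; apply/boundary_unit_ballE.
Qed.

Lemma Delta_lt (b : R) : Delta F < b -> exists P Q : R * R,
  [/\ F P = 1, F Q = 1, F (P + Q) = 1 & parallelogram_area P Q < b].
Proof.
case: areas_has_inf => areas0 _ /(inf_lt areas0)[a [P [Q [hP hQ hS ->]]] ab].
by exists P, Q; split=> //; apply/boundary_unit_ballE.
Qed.

Lemma Delta_le1 : Delta F <= 1.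
Proof.
have [l [P [Q [_ hP hQ hS [ha _]]]]] := ssn_hexagon.
apply: le_trans (Delta_le hP hQ hS) (le_trans ha _).
by have := sqr_ge0 l; lra.
Qed.

Lemma Delta_lt1 : 1 < F (1, 1) -> Delta F < 1.
Proof.
move=> F1; have [l [P [Q [/andP[l0 _] hP hQ hS [ha hl]]]]] := ssn_hexagon.
apply: le_lt_trans (Delta_le hP hQ hS) (le_lt_trans ha _).
have l1 : 0 < l.
  by rewrite lt_neqAle l0 andbT; apply/eqP => /esym /hl e; rewrite e ltxx in F1.
by have := exprn_gt0 2 l1; lra.
Qed.

End StronglySymmetricNorm.

(** * Continued fractions *)

(* The sequences of numerators (u0 = 1) and denominators (u0 = 0, u1 = 1) of the
   convergents are indexed from 1/0, so that u 1 belongs to the integer part and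
   a 0 is the first partial quotient after it. *)
Fixpoint cf_rec (a : nat -> nat) (u0 u1 : int) (n : nat) : int :=
  match n with
  | 0 => u0
  | m.+1 => match m with
            | 0 => u1
            | k.+1 => (a k)%:Z * cf_rec a u0 u1 m + cf_rec a u0 u1 k
            end
  end.

Definition cf_den (a : nat -> nat) : nat -> int := cf_rec a 0 1.
Definition cf_num (a : nat -> nat) (k : int) : nat -> int := cf_rec a 1 k.

Lemma cf_denSS a n : cf_den a n.+2 = (a n)%:Z * cf_den a n.+1 + cf_den a n.
Proof. by []. Qed.

Lemma cf_numSS a k n :
  cf_num a k n.+2 = (a n)%:Z * cf_num a k n.+1 + cf_num a k n.
Proof. by []. Qed.

Lemma cf_det a k n :
  cf_num a k n * cf_den a n.+1 - cf_num a k n.+1 * cf_den a n = (-1) ^+ n.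
Proof.
elim: n => [|n IHn]; first by rewrite /cf_num /cf_den /=; ring.
by rewrite cf_denSS cf_numSS exprS -IHn; ring.
Qed.

Lemma cf_den_ge0 a n : 0 <= cf_den a n.
Proof.
suff: 0 <= cf_den a n /\ 0 <= cf_den a n.+1 by case.
elim: n => [//|n [h0 h1]]; split=> //.
by rewrite cf_denSS addr_ge0// mulr_ge0.
Qed.

Section ContinuedFraction.
Variable R : realType.
Implicit Types (alpha : R) (a : nat -> nat).

(** The sign is the one that makes the error positive along the continued fraction of alpha. *)
Definition cf_err alpha a k (n : nat) : R :=
  (-1) ^+ n.+1 * ((cf_den a n)%:~R * alpha - (cf_num a k n)%:~R).

(** Positive errors mean that the convergents lie alternately on the two sides of alpha; with
    positive digits this characterises the expansion without any limit. *)
Definition is_cf alpha a k :=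
  (forall n, (0 < a n)%N) /\ (forall n, 0 < cf_err alpha a k n).

(** A division step of Euclid's algorithm: when the errors are positive, [a n] is the quotient of
    consecutive errors and the next error is the remainder. *)
Lemma cf_err_rec alpha a k n :
  cf_err alpha a k n = (a n)%:R * cf_err alpha a k n.+1 + cf_err alpha a k n.+2.
Proof.
by rewrite /cf_err cf_denSS cf_numSS !rmorphD !rmorphM /= !exprS; ring.
Qed.

Lemma cf_err0 alpha a k : cf_err alpha a k 0 = 1.
Proof. by rewrite /cf_err /cf_den /cf_num /=; ring. Qed.

Lemma cf_err1 alpha a k : cf_err alpha a k 1 = alpha - k%:~R.
Proof. by rewrite /cf_err /cf_den /cf_num /=; ring. Qed.

Lemma cf_err_unimodular alpha a k n :
  (cf_den a n.+1)%:~R * cf_err alpha a k n + (cf_den a n)%:~R * cf_err alpha a k n.+1 = 1.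
Proof.
have := congr1 (fun z : int => z%:~R : R) (cf_det a k n).
rewrite rmorphB !rmorphM /= rmorphXn /= => det.
have s2 : (-1) ^+ n * (-1) ^+ n = 1 :> R by rewrite -expr2 sqrr_sign.
by rewrite /cf_err !exprS -[RHS]s2 -[X in _ = _ * X]det; ring.
Qed.

Section Positive.
Variables (alpha : R) (a : nat -> nat) (k : int).
Hypothesis cfa : is_cf alpha a k.
Let s := cf_err alpha a k.
Let q n : R := (cf_den a n)%:~R.

Lemma cf_den_ge1 n : 1 <= cf_den a n.+1.
Proof.
have [a0 _] := cfa.
elim: n => [//|n IHn]; rewrite cf_denSS.
have := cf_den_ge0 a n; have := a0 n; nia.
Qed.

Lemma cf_den_ge n : n%:Z <= cf_den a n.+1.
Proof.
have [a0 _] := cfa.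
elim: n => [//|[|n] IHn]; first exact: (cf_den_ge1 1).
rewrite cf_denSS; have := cf_den_ge1 n; have := a0 n.+1; nia.
Qed.

Lemma cf_den_le n : cf_den a n <= cf_den a n.+1.
Proof.
have [a0 _] := cfa; case: n => [//|n]; rewrite cf_denSS.
have := cf_den_ge0 a n; have := cf_den_ge0 a n.+1; have := a0 n; nia.
Qed.

Lemma cf_err_decr n : s n.+1 < s n.
Proof.
have [a0 s0] := cfa.
rewrite {2}/s cf_err_rec -/s; have := s0 n.+2; have := s0 n.+1.
have : 1 <= (a n)%:R :> R by rewrite ler1n.
rewrite -/s; nra.
Qed.

Lemma cf_err_le1 n : q n.+1 * s n <= 1.
Proof.
have := cf_err_unimodular alpha a k n; have [_ s0] := cfa.
have : 0 <= q n by rewrite ler0z cf_den_ge0.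
have := s0 n.+1; rewrite -/s -/(q n) -/(q n.+1); nra.
Qed.

Lemma cf_den_bracket (T : R) : 1 <= T -> exists n, q n.+1 <= T < q n.+2.
Proof.
move=> T1.
have ex : exists n, T < q n.+1.
  have T0 : 0 <= T by lra.
  exists (Num.truncn T).+1; apply: (@lt_le_trans _ _ (Num.truncn T).+1%:R).
    by case/andP: (truncn_itv T0).
  by rewrite -[leLHS]/((Num.truncn T).+1%:Z%:~R) ler_int cf_den_ge.
case: (ex_minnP ex) => -[|m] hm min_m.
  by move: hm; rewrite /q /cf_den /= => hm; exfalso; lra.
exists m; rewrite hm andbT leNgt; apply/negP => h.
by have := min_m _ h; rewrite ltnn.
Qed.

(** If alpha = c/d, then d times any error is a positive integer, hence at least 1. But the error of
    index d + 1 is at most 1/(d + 1). *)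
Lemma is_cf_irrational : irrational alpha.
Proof.
move=> /rationalP[c [d e]]; have [_ s0] := cfa.
(* Division by 0 yields 0, so a denominator 0 stands for alpha = 0/1. *)
wlog d0 : c d e / (0 < d)%N => [wl|].
  have [d0|] := posnP d; last exact: wl e.
  by apply: (wl 0 1%N) => //; rewrite e d0 invr0 mulr0 mul0r.
have dR : 0 < d%:R :> R by rewrite ltr0n.
have sd n : 1 <= d%:R * s n.
  have E : d%:R * s n = ((-1) ^+ n.+1 * (cf_den a n * c - cf_num a k n * d%:Z))%:~R.
    rewrite rmorphM rmorphXn rmorphB !rmorphM /= /s /cf_err e.
    rewrite -[d%:~R]/(d%:R); field; exact: lt0r_neq0.
  have : 0 < d%:R * s n by rewrite mulr_gt0.
  by rewrite E -[1]/(1%:~R) ltr0z ler_int; lia.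
have h := cf_err_le1 d.+1; have := sd d.+1.
have : (d.+1)%:R <= q d.+2 by rewrite -[leLHS]/((d.+1)%:Z%:~R) ler_int cf_den_ge.
rewrite -natr1 => hq hs; have := s0 d.+1; rewrite -/s => s1; nra.
Qed.

End Positive.

(** If the convergents agree up to index m + 1, both digits are the integer quotient of the same two
    errors, with a remainder strictly between 0 and the divisor. *)
Lemma cf_digits_unique alpha a b k : is_cf alpha a k -> is_cf alpha b k ->
  forall n, a n = b n.
Proof.
move=> cfa cfb n.
have same m : cf_den a m = cf_den b m -> cf_den a m.+1 = cf_den b m.+1 ->
    cf_num a k m = cf_num b k m -> cf_num a k m.+1 = cf_num b k m.+1 -> a m = b m.
  move=> d0 d1 n0 n1.
  have e0 : cf_err alpha a k m = cf_err alpha b k m by rewrite /cf_err d0 n0.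
  have e1 : cf_err alpha a k m.+1 = cf_err alpha b k m.+1 by rewrite /cf_err d1 n1.
  have ra := cf_err_rec alpha a k m; have rb := cf_err_rec alpha b k m.
  have [_ /(_ m.+1) s1] := cfa.
  have [_ /(_ m.+2) sa] := cfa; have [_ /(_ m.+2) sb] := cfb.
  have da := cf_err_decr cfa m.+1; have db := cf_err_decr cfb m.+1.
  rewrite e0 e1 in ra; rewrite e1 in s1 da.
  have [ab|ab|//] := ltngtP (a m) (b m); exfalso.
    have : (a m)%:R + 1 <= (b m)%:R :> R by rewrite natr1 ler_nat.
    nra.
  have : (b m)%:R + 1 <= (a m)%:R :> R by rewrite natr1 ler_nat.
  nra.
suff [d0 d1 n0 n1] : [/\ cf_den a n = cf_den b n, cf_den a n.+1 = cf_den b n.+1,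
    cf_num a k n = cf_num b k n & cf_num a k n.+1 = cf_num b k n.+1].
  exact: same.
elim: n => [//|n [d0 d1 n0 n1]]; split=> //.
  by rewrite !cf_denSS d0 d1 (same n).
by rewrite !cf_numSS n0 n1 (same n).
Qed.

(** * Existence of expansions, and numbers with prescribed digits *)

Fixpoint gauss_iter (x : R) (n : nat) : R :=
  match n with
  | 0 => x - (Num.floor x)%:~R
  | m.+1 => (gauss_iter x m)^-1 - (Num.floor (gauss_iter x m)^-1)%:~R
  end.

Lemma gauss_iter_irrational (x : R) n : irrational x -> irrational (gauss_iter x n).
Proof.
move=> ix; elim: n => [|n IHn] /=.
  move=> [r _ e]; apply: ix; exists (r + (Num.floor x)%:~R) => //.
  by rewrite rmorphD /= ratr_int e subrK.
set y := gauss_iter x n in IHn *; move=> [r _ e]; apply: IHn.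
exists ((r + (Num.floor y^-1)%:~R)^-1) => //.
by rewrite fmorphV rmorphD /= ratr_int e subrK invrK.
Qed.

Lemma gauss_iter_itv (x : R) n : irrational x -> 0 < gauss_iter x n < 1.
Proof.
move=> /(@gauss_iter_irrational _ n) ix.
have [lb ub] : 0 <= gauss_iter x n /\ gauss_iter x n < 1.
  case: n {ix} => [|n] /=; set y := (Y in Y - (Num.floor Y)%:~R);
    by have := floor_le_tmp y; have := floorD1_gt y; rewrite intrD; split; lra.
rewrite lt_neqAle lb ub !andbT; apply/eqP => e; apply: ix.
by exists 0 => //; rewrite -e rmorph0.
Qed.

Lemma irrational_cf alpha : irrational alpha -> exists a k, is_cf alpha a k.
Proof.
move=> ia; pose x := gauss_iter alpha.
pose a n := `|Num.floor (x n)^-1|%N; pose k := Num.floor alpha.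
have x01 n : 0 < x n < 1 := gauss_iter_itv n ia.
have fl n : 1 <= Num.floor (x n)^-1.
  have /andP[x0 x1] := x01 n.
  by rewrite floor_ge_int_tmp invf_ge1// ltW.
have aE n : (a n)%:R = (Num.floor (x n)^-1)%:~R :> R.
  by rewrite -[LHS]/((a n)%:Z%:~R) /a gez0_abs//; have := fl n; lia.
exists a, k; split=> [n|]; first by rewrite absz_gt0; have := fl n; lia.
(* The orbit of the Gauss map consists of the ratios of consecutive errors, so positivity propagates
   from the error 1 at index 0. *)
have step n : cf_err alpha a k n.+1 = x n * cf_err alpha a k n.
  elim: n => [|n IHn]; first by rewrite cf_err0 cf_err1 mulr1.
  have := cf_err_rec alpha a k n; rewrite IHn aE.
  have /andP[x0 _] := x01 n.
  have -> : x n.+1 = (x n)^-1 - (Num.floor (x n)^-1)%:~R by [].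
  move=> /esym/eqP; rewrite addrC eq_sym -subr_eq => /eqP <-.
  by field; exact: lt0r_neq0.
elim=> [|n IHn]; first by rewrite cf_err0.
by rewrite step mulr_gt0//; case/andP: (x01 n).
Qed.

(** The convergents [L] increase, the convergents [U] decrease, and every [L] is below every [U].
    The supremum of [L] lies strictly between them by strict monotonicity, which is the positivity
    of the errors. *)
Lemma cf_of_digits a : (forall n, (0 < a n)%N) -> exists alpha, is_cf alpha a 0.
Proof.
move=> a0.
pose q n : R := (cf_den a n)%:~R; pose p n : R := (cf_num a 0 n)%:~R.
have q0 n : 0 < q n.+1.
  rewrite ltr0z; elim: n => [//|n IHn]; rewrite cf_denSS.
  have := cf_den_ge0 a n; have := a0 n; nia.
(* The shift by one skips the convergent 1/0, so that [c 0] is the integer part. *)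
pose c n := p n.+1 / q n.+1.
have det n : p n * q n.+1 - p n.+1 * q n = (-1) ^+ n.
  by rewrite /p /q -!rmorphM -rmorphB cf_det rmorphXn.
have det2 n : p n * q n.+2 - p n.+2 * q n = (a n)%:R * (-1) ^+ n.
  by rewrite -det /p /q cf_denSS cf_numSS !rmorphD !rmorphM /=; ring.
have cS n : c n - c n.+1 = - ((-1) ^+ n / (q n.+1 * q n.+2)).
  have := det n.+1; rewrite exprS /c => d.
  have -> : (-1) ^+ n = p n.+2 * q n.+1 - p n.+1 * q n.+2 by lra.
  by field; rewrite !(lt0r_neq0 (q0 _)).
have cSS n : c n - c n.+2 = - ((a n.+1)%:R * (-1) ^+ n / (q n.+1 * q n.+3)).
  have := det2 n.+1; rewrite exprS /c => d.
  have -> : (a n.+1)%:R * (-1) ^+ n = p n.+3 * q n.+1 - p n.+1 * q n.+3 by lra.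
  by field; rewrite !(lt0r_neq0 (q0 _)).
pose L j := c j.*2; pose U j := c j.*2.+1.
have sgn j : (-1) ^+ j.*2 = 1 :> R by rewrite -signr_odd odd_double.
have LU j : L j < U j.
  rewrite -subr_lt0 cS sgn oppr_lt0 divr_gt0// mulr_gt0//.
have Lincr j : L j < L j.+1.
  by rewrite -subr_lt0 /L doubleS cSS sgn mulr1 oppr_lt0 divr_gt0 ?mulr_gt0// ltr0n.
have Udecr j : U j.+1 < U j.
  rewrite -subr_gt0 /U doubleS cSS exprS sgn mulr1 mulrN1 mulNr opprK.
  by rewrite divr_gt0 ?mulr_gt0// ltr0n.
have Lhomo : {homo L : i j / (i <= j)%N >-> i <= j}.
  by apply: homo_leq => [//|? ? ?|j]; [exact: le_trans | exact: ltW].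
have Uhomo : {homo U : i j / (i <= j)%N >-> j <= i}.
  by apply: (@homo_leq _ U (fun x y => y <= x)) => [//|? ? ? h1 h2|j];
     [exact: le_trans h2 h1 | exact: ltW].
have LUij i j : L i <= U j.
  apply: le_trans (Lhomo _ _ (leq_maxl i j)) (le_trans (ltW (LU _)) _).
  exact: Uhomo (leq_maxr i j).
pose alpha := sup (range L).
have ubL : has_sup (range L).
  by split; [exists (L 0), 0%N | exists (U 0) => _ [i _ <-]; exact: LUij].
have Lalpha j : L j < alpha.
  by apply: lt_le_trans (Lincr j) _; apply: ub_le_sup; [case: ubL | exists j.+1].
have alphaU j : alpha < U j.
  apply: le_lt_trans (Udecr j); apply: ge_sup; first by case: ubL.
  by move=> _ [i _ <-]; exact: LUij.
exists alpha; split=> // -[|n]; first by rewrite cf_err0.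
rewrite /cf_err -/(q _) -/(p _).
have pE m : p m.+1 = c m * q m.+1 by rewrite /c divfK// lt0r_neq0.
rewrite pE [q _ * _]mulrC -mulrBl mulrA pmulr_lgt0//.
rewrite -(odd_double_half n); case: (odd n); rewrite ?add1n ?add0n !exprS sgn.
  by have := alphaU n./2; rewrite /U; lra.
by have := Lalpha n./2; rewrite /L; lra.
Qed.

End ContinuedFraction.

(** * Improvability *)

Section Improvability.
Variables (R : realType) (F : R * R -> R).
Hypothesis hF : strongly_symmetric_norm F.

Lemma approximable_le (alpha c c' t : R) :
  c <= c' -> approximable F alpha c t -> approximable F alpha c' t.
Proof.
move=> cc' [p [q [q0 h]]]; exists p, q; split=> //; exact: lt_le_trans cc'.
Qed.

Lemma approximable_gt0 (alpha c t : R) : approximable F alpha c t -> 0 < c.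
Proof.
move=> [p [q [_]]]; apply: le_lt_trans.
by rewrite mulr_ge0 ?sqr_ge0// ltW// Delta_gt0.
Qed.

(** The norm ignores the sign of the second coordinate, so the signed error can replace p - alpha q;
    the index [n.+1] makes q positive. *)
Lemma cf_approximable (alpha c t : R) a k n : is_cf alpha a k ->
  Delta F * F (t^-1 * (cf_den a n.+1)%:~R, t * cf_err alpha a k n.+1) ^+ 2 < c ->
  approximable F alpha c t.
Proof.
move=> cfa h; exists (cf_num a k n.+1), (cf_den a n.+1); split.
  by have := cf_den_ge1 cfa n; lia.
apply: le_lt_trans h; rewrite /scaled_norm /=; set x := _ - _.
suff -> : F (t^-1 * (cf_den a n.+1)%:~R, t * x) =
          F (t^-1 * (cf_den a n.+1)%:~R, t * cf_err alpha a k n.+1) by [].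
have -> : cf_err alpha a k n.+1 = (-1) ^+ n.+1 * x.
  by rewrite /cf_err /x exprS; ring.
by rewrite -signr_odd; case: (odd _); rewrite ?expr1 ?mulN1r ?mulrN ?(ssnNr hF) ?mul1r.
Qed.

(** This makes the set of eventually valid constants nonempty. For consecutive denominators q <= t <
    q' the error e is at most 1/q', so q/t and te are at most 1 and F is at most 2. *)
Lemma irrational_approximable (alpha : R) : irrational alpha ->
  exists c, \forall t \near +oo, approximable F alpha c t.
Proof.
move=> /irrational_cf[a [k cfa]]; exists (Delta F * 4 + 1).
exists 1; split=> // t t1; have t0 : 0 < t by lra.
have [n /andP[h1 h2]] := cf_den_bracket cfa (ltW t1).
apply: (@cf_approximable _ _ _ a k n cfa).
have e0 := cfa.2 n.+1; have ele := cf_err_le1 cfa n.+1.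
have q0 : 0 <= (cf_den a n.+1)%:~R :> R by rewrite ler0z cf_den_ge0.
move: (cf_err alpha a k n.+1) e0 ele => e e0 ele.
move: ((cf_den a n.+1)%:~R : R) ((cf_den a n.+2)%:~R : R) h1 h2 q0 ele => q q' h1 h2 q0 ele.
have tq0 : 0 <= t^-1 * q by apply: mulr_ge0; [rewrite invr_ge0 ltW | lra].
have te0 : 0 <= t * e by apply: mulr_ge0; exact: ltW.
have D0 := Delta_gt0 hF.
have Fle : F (t^-1 * q, t * e) <= 2.
  apply: le_trans (ssn_le_sum hF _ _) _.
  rewrite (ger0_norm tq0) (ger0_norm te0).
  have : t^-1 * q <= 1 by rewrite mulrC ler_pdivrMr// mul1r.
  have : t * e <= 1 by nra.
  lra.
have F0 := ssn_ge0 hF (t^-1 * q) (t * e).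
have : F (t^-1 * q, t * e) ^+ 2 <= 4 by rewrite expr2; nra.
nra.
Qed.

(** The set [S] of eventually valid constants is upward closed, nonempty and bounded below by 0. Its
    infimum is the only number satisfying [delta_spec], hence equals [delta]. *)
Lemma delta_lt1P (alpha : R) : irrational alpha ->
  delta F alpha < 1 <->
  exists2 c, c < 1 & \forall t \near +oo, approximable F alpha c t.
Proof.
move=> ia.
pose S := [set c | \forall t \near +oo, approximable F alpha c t].
have S0 : S !=set0 := irrational_approximable ia.
have Sup c c' : c <= c' -> S c -> S c'.
  by move=> cc'; apply: filterS => t; exact: approximable_le.
have lbS : lbound S 0.
  by move=> c /filter_ex[t /approximable_gt0/ltW].
have hS : has_inf S by split=> //; exists 0.
have lt_inf c : inf S < c -> S c.
  by move=> /(inf_lt S0)[c' Sc' c'c]; apply: Sup Sc'; exact: ltW.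
have inf_le c : S c -> inf S <= c by move=> Sc; apply: ge_inf => //; case: hS.
have spec : delta_spec F alpha (inf S).
  split=> [//|c cinf T]; apply: contrapT => noT.
  suff /inf_le : S c by rewrite leNgt cinf.
  exists T; split; first exact: num_real.
  by move=> t Tt; apply: contrapT => nt; apply: noT; exists t.
have -> : delta F alpha = inf S.
  rewrite /delta (_ : mkset _ = [set inf S]) ?sup1//.
  apply/seteqP; split=> d /=; last by move=> ->.
  move=> [h1 h2]; apply/eqP; rewrite eq_le; apply/andP; split; last first.
    by apply/ler_addgt0Pr => e e0; apply: inf_le; apply: h1; rewrite ltrDl.
  rewrite leNgt; apply/negP => infd.
  (* The midpoint would be valid for all large t, being above [inf S], and fail at some large t,
     being below [d]. *)
  have [c1 c2] : inf S < (inf S + d) / 2 /\ (inf S + d) / 2 < d by split; lra.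
  have [M [_ hM]] := lt_inf _ c1.
  by have [t Mt] := h2 _ c2 M; apply; exact: hM.
split=> [h|[c c1 /inf_le h]]; last exact: le_lt_trans c1.
exists ((inf S + 1) / 2); first by lra.
by apply: lt_inf; lra.
Qed.

(** Here [F] is the sup norm. The convergent with the last denominator q' <= 99t/100 works: q'/t <=
    99/100, and te < (100/99) qe <= 10/11 for the next denominator q. *)
Lemma improvable_bounded_digits (alpha : R) a k : F (1, 1) <= 1 ->
  is_cf alpha a k -> (forall n, (a n <= 2)%N) -> delta F alpha < 1.
Proof.
move=> F1 cfa a2; apply/(delta_lt1P (is_cf_irrational cfa)).
exists (99 / 100); first by lra.
exists 2; split=> // t t2; have t0 : 0 < t by lra.
have T1 : 1 <= 99 / 100 * t by lra.
have [n /andP[h1 h2]] := cf_den_bracket cfa T1.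
apply: (@cf_approximable _ _ _ a k n cfa).
have e1 := cfa.2 n.+1; have e2 := cfa.2 n.+2; have e32 := cf_err_decr cfa n.+2.
have er := cf_err_rec alpha a k n.+1.
have un := cf_err_unimodular alpha a k n.+1.
have qr : (cf_den a n.+2)%:~R = (a n)%:R * (cf_den a n.+1)%:~R + (cf_den a n)%:~R :> R.
  by rewrite cf_denSS rmorphD rmorphM.
have qle : (cf_den a n)%:~R <= (cf_den a n.+1)%:~R :> R. by rewrite ler_int (cf_den_le cfa).
have q0 : 1 <= (cf_den a n.+1)%:~R :> R by rewrite -[1]/(1%:~R) ler_int (cf_den_ge1 cfa).
have an : (a n)%:R <= 2 :> R by rewrite ler_nat.
have an1 : (a n.+1)%:R <= 2 :> R by rewrite ler_nat.
move: (cf_err alpha a k n.+1) (cf_err alpha a k n.+2) (cf_err alpha a k n.+3) e1 e2 e32 er un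
  => e e' e'' e1 e2 e32 er un.
move: ((cf_den a n.+2)%:~R : R) ((cf_den a n.+1)%:~R : R) ((cf_den a n)%:~R : R)
  h1 h2 qr qle q0 un => q q' q'' h1 h2 qr qle q0 un.
have D0 := Delta_gt0 hF; have D1 := Delta_le1 hF.
have e3 : e <= 3 * e' by nra.
have q3 : q <= 3 * q' by nra.
(* Digits at most 2 give q <= 3q' and e <= 3e'; then qe + q'e' = 1 leaves at most 9/10 for qe. *)
have qe : q * e <= 9 / 10.
  have : q * e <= (3 * q') * (3 * e') by apply: ler_pM => //; nra.
  nra.
have tq0 : 0 <= t^-1 * q' by apply: mulr_ge0; [rewrite invr_ge0 ltW | lra].
have te0 : 0 <= t * e by apply: mulr_ge0; exact: ltW.
have Fle : F (t^-1 * q', t * e) <= 99 / 100.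
  apply: (ssn_le_max hF) => //; rewrite ?(ger0_norm tq0) ?(ger0_norm te0); last by nra.
  by rewrite mulrC ler_pdivrMr.
have F0 := ssn_ge0 hF (t^-1 * q') (t * e).
have : F (t^-1 * q', t * e) ^+ 2 <= (99 / 100) ^+ 2 by rewrite ler_pXn2r ?nnegrE//; lra.
nra.
Qed.

(** For consecutive denominators q <= t < q', the coordinates q/t and te are at most 1 and their
    product qe is at most [eta ^+ 2], since q' is at least [a n] times q. So one of them is at most
    [eta], and F <= 1 + eta. *)
Lemma improvable_large_digits : 1 < F (1, 1) -> exists2 N : nat, (0 < N)%N &
  forall (alpha : R) a k, is_cf alpha a k -> (forall n, (N <= a n)%N) -> delta F alpha < 1.
Proof.
move=> F1; have D1 := Delta_lt1 hF F1; have D0 := Delta_gt0 hF.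
(* With Delta = 1 - 4 eta, the product Delta (1 + eta)^2 stays below 1. *)
pose eta := (1 - Delta F) / 4; have eta0 : 0 < eta by rewrite /eta; lra.
pose N := (Num.truncn (eta ^- 2)).+1.
have NE : eta ^- 2 <= N%:R by apply/ltW/truncnS_gt.
exists N => // alpha a k cfa aN.
apply/(delta_lt1P (is_cf_irrational cfa)).
have c1 : Delta F * (1 + eta) ^+ 2 < 1.
  have De : Delta F = 1 - 4 * eta by rewrite /eta; lra.
  by rewrite De in D0 *; nra.
exists ((1 + Delta F * (1 + eta) ^+ 2) / 2); first by lra.
exists 1; split=> // t t1; have t0 : 0 < t by lra.
have [n /andP[h1 h2]] := cf_den_bracket cfa (ltW t1).
apply: (@cf_approximable _ _ _ a k n cfa).
have e0 := cfa.2 n.+1; have ele := cf_err_le1 cfa n.+1.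
have aE : 1 <= (a n)%:R * eta ^+ 2.
  rewrite -ler_pdivrMr ?exprn_gt0// mul1r; apply: le_trans NE _.
  by rewrite ler_nat.
have q2 : (a n)%:R * (cf_den a n.+1)%:~R <= (cf_den a n.+2)%:~R :> R.
  by rewrite cf_denSS rmorphD rmorphM /= lerDl ler0z cf_den_ge0.
have q0 : 1 <= (cf_den a n.+1)%:~R :> R by rewrite -[1]/(1%:~R) ler_int (cf_den_ge1 cfa).
move: (cf_err alpha a k n.+1) e0 ele => e e0 ele.
move: ((cf_den a n.+1)%:~R : R) ((cf_den a n.+2)%:~R : R) h1 h2 q2 q0 ele => q q' h1 h2 q2 q0 ele.
have tq0 : 0 <= t^-1 * q by apply: mulr_ge0; [rewrite invr_ge0 ltW | lra].
have te0 : 0 <= t * e by apply: mulr_ge0; exact: ltW.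
have tq1 : t^-1 * q <= 1 by rewrite mulrC ler_pdivrMr// mul1r.
have Fle : F (t^-1 * q, t * e) <= 1 + eta.
  apply: le_trans (ssn_le_sum hF _ _) _.
  rewrite (ger0_norm tq0) (ger0_norm te0).
  have [small|big] := leP (t^-1 * q) eta.
    have : t * e <= 1 by nra.
    lra.
  apply: lerD => //.
  have tq : eta * t <= q by rewrite -ler_pdivlMr// mulrC ltW.
  have qe : q * e <= eta ^+ 2.
    have h : (a n)%:R * (q * e) <= (a n)%:R * eta ^+ 2.
      apply: le_trans aE; apply: le_trans ele; rewrite mulrA ler_wpM2r// ltW//.
    have an0 : 0 < (a n)%:R :> R by rewrite ltr0n cfa.1.
    by rewrite -(ler_pM2l an0).
  have : eta * (t * e) <= eta * eta.
    rewrite mulrA -expr2; apply: le_trans qe; rewrite ler_wpM2r// ltW//.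
  by rewrite ler_pM2l.
have F0 := ssn_ge0 hF (t^-1 * q) (t * e).
have : F (t^-1 * q, t * e) ^+ 2 <= (1 + eta) ^+ 2 by rewrite ler_pXn2r ?nnegrE//; lra.
nra.
Qed.

(** * Uncountability *)

Lemma not_countable_of_bool_seq (T : choiceType) (S : set T) (f : (nat -> bool) -> T) :
  injective f -> (forall b, S (f b)) -> ~ countable S.
Proof.
move=> finj fS /countable_injP[g ginj].
have hinj b b' : g (f b) = g (f b') -> b = b'.
  by move=> e; apply/finj/ginj => //; rewrite inE.
(* Cantor's diagonal sequence: it contradicts itself at the code of its own image. *)
pose d n := ~~ `[< exists b, g (f b) = n /\ b n >].
have : d (g (f d)) = ~~ d (g (f d)).
  rewrite {1}/d; congr (~~ _); apply/asboolP/idP; last by exists d.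
  by move=> [b [/hinj <-]].
by case: (d _).
Qed.

(** Digits from {N, N + 1} encode 0-1 sequences injectively: N = 1 for the sup norm, a large N
    otherwise. *)
Lemma uncountable_improvable :
  ~ countable [set alpha : R | irrational alpha /\ delta F alpha < 1].
Proof.
have [N N0 hN] : exists2 N : nat, (0 < N)%N & forall (alpha : R) a, is_cf alpha a 0 ->
    (forall n, (N <= a n <= N.+1)%N) -> delta F alpha < 1.
  have [F1|F1] := leP (F (1, 1)) 1.
    exists 1%N => // alpha a cfa aN; apply: (improvable_bounded_digits F1 cfa) => n.
    by case/andP: (aN n).
  have [N N0 h] := improvable_large_digits F1; exists N => // alpha a cfa aN.
  by apply: h cfa _ => n; case/andP: (aN n).
pose dig (b : nat -> bool) n := (N + b n)%N.
have ex (b : nat -> bool) : exists alpha : R, is_cf alpha (dig b) 0.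
  by apply: cf_of_digits => n; rewrite /dig; lia.
have [f hf] := choice ex.
apply: (@not_countable_of_bool_seq _ _ f).
  move=> b b' e; apply/funext => n; have h := hf b'; rewrite -e in h.
  have := cf_digits_unique (hf b) h n; rewrite /dig.
  by case: (b n); case: (b' n) => //; lia.
move=> b; split; first exact: is_cf_irrational (hf b).
by apply: hN (hf b) _ => n; rewrite /dig; case: (b n); lia.
Qed.

End Improvability.

(** * Admissible lattices *)

Section Lattices.
Variables (R : realType) (F : R * R -> R).
Hypothesis hF : strongly_symmetric_norm F.
Implicit Types (x y : R) (m n : int).

(* The second bound makes admissibility stable under small perturbations of the
   basis, uniformly in m and n. *)
Definition admissible_basis x1 y1 x2 y2 := forall m n, ~ (m = 0 /\ n = 0) ->
  let N := F (m%:~R * x1 + n%:~R * x2, m%:~R * y1 + n%:~R * y2) in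
  1 <= N /\ `|m%:~R| + `|n%:~R| <= 3 * N.

(** The vector mP + nQ is a combination of any two of the unit vectors P, Q, P + Q, with
    coefficients two of m, n, n - m up to sign. So the absolute values of these three integers
    differ pairwise by at most N. The largest is the sum of the others, which are thus at most N
    each; this gives the factor 3. If N < 1, the three are equal, hence zero. *)
Lemma hexagon_admissible x1 y1 x2 y2 : F (x1, y1) = 1 -> F (x2, y2) = 1 ->
  F (x1 + x2, y1 + y2) = 1 -> admissible_basis x1 y1 x2 y2.
Proof.
move=> F1 F2 F3 m n mn0 /=.
set N := F _.
have h1 : `|m%:~R| - `|n%:~R| <= N.
  have := ssn_triangleB hF (m%:~R * x1) (m%:~R * y1) (- n%:~R * x2) (- n%:~R * y2).
  by rewrite !ssnZ// F1 F2 normrN !mulr1 !mulNr !opprK.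
have h2 : `|n%:~R| - `|m%:~R| <= N.
  have := ssn_triangleB hF (n%:~R * x2) (n%:~R * y2) (- m%:~R * x1) (- m%:~R * y1).
  by rewrite !ssnZ// F1 F2 normrN !mulr1 !mulNr !opprK ![n%:~R * _ + _]addrC.
have h3 : `|m%:~R| - `|n%:~R - m%:~R| <= N.
  have := ssn_triangleB hF (m%:~R * (x1 + x2)) (m%:~R * (y1 + y2))
    ((m%:~R - n%:~R) * x2) ((m%:~R - n%:~R) * y2).
  rewrite !ssnZ// F2 F3 !mulr1 [`|m%:~R - _|]distrC; congr (_ <= F (_, _)); ring.
have h4 : `|n%:~R - m%:~R| - `|m%:~R| <= N.
  have := ssn_triangleB hF ((n%:~R - m%:~R) * x2) ((n%:~R - m%:~R) * y2)
    (- m%:~R * (x1 + x2)) (- m%:~R * (y1 + y2)).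
  rewrite !ssnZ// F2 F3 !mulr1 normrN; congr (_ <= F (_, _)); ring.
have h5 : `|n%:~R| - `|n%:~R - m%:~R| <= N.
  have := ssn_triangleB hF (n%:~R * (x1 + x2)) (n%:~R * (y1 + y2))
    ((n%:~R - m%:~R) * x1) ((n%:~R - m%:~R) * y1).
  rewrite !ssnZ// F1 F3 !mulr1; congr (_ <= F (_, _)); ring.
have h6 : `|n%:~R - m%:~R| - `|n%:~R| <= N.
  have := ssn_triangleB hF ((m%:~R - n%:~R) * x1) ((m%:~R - n%:~R) * y1)
    (- n%:~R * (x1 + x2)) (- n%:~R * (y1 + y2)).
  rewrite !ssnZ// F1 F3 !mulr1 normrN [`|m%:~R - _|]distrC; congr (_ <= F (_, _)); ring.
split; last first.
  move: h1 h2 h3 h4 h5 h6; case: (ger0P (m%:~R : R)) => ?;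
  case: (ger0P (n%:~R : R)) => ?; case: (ger0P (n%:~R - m%:~R : R)) => ?; lra.
rewrite leNgt; apply/negP => N1.
have int_lt1 (i j : int) : i%:~R - j%:~R <= N -> i <= j.
  move=> ij; have : (i - j)%:~R < 1%:~R :> R by rewrite rmorphB /=; lra.
  by rewrite ltr_int; lia.
rewrite -rmorphB /= -!intr_norm in h1 h2 h3 h4 h5 h6.
have := int_lt1 _ _ h1; have := int_lt1 _ _ h2; have := int_lt1 _ _ h3.
have := int_lt1 _ _ h4; lia.
Qed.

Lemma admissible_oppl x1 y1 x2 y2 :
  admissible_basis x1 y1 x2 y2 -> admissible_basis (- x1) (- y1) x2 y2.
Proof.
move=> h m n mn0 /=; have [|h1 h2] := h (- m) n; first by lia.
move: h1 h2; rewrite rmorphN /= normrN !mulNr !mulrN; by split.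
Qed.

Lemma admissible_oppr x1 y1 x2 y2 :
  admissible_basis x1 y1 x2 y2 -> admissible_basis x1 y1 (- x2) (- y2).
Proof.
move=> h m n mn0 /=; have [|h1 h2] := h m (- n); first by lia.
move: h1 h2; rewrite rmorphN /= normrN !mulNr !mulrN; by split.
Qed.

(** Negating a basis vector preserves the lattice, so the vectors can be moved to the closed
    quadrants I and IV. The two terms of the determinant then do not cancel. *)
Lemma admissible_opposite_signs x1 y1 x2 y2 :
  admissible_basis x1 y1 x2 y2 -> 0 <= x1 * y1 -> x2 * y2 <= 0 ->
  admissible_basis `|x1| `|y1| `|x2| (- `|y2|) /\
  `|x1| * `|y2| + `|x2| * `|y1| = `|x1 * y2 - y1 * x2|.
Proof.
move=> adm p1 p2; split.
  have {}adm : admissible_basis `|x1| `|y1| x2 y2.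
    have e : x1 = `|x1| /\ y1 = `|y1| \/ x1 = - `|x1| /\ y1 = - `|y1|.
      case: (ger0P x1) => ?; case: (ger0P y1) => ?; rewrite ?opprK; try by [left | right].
        by have -> : x1 = 0; [nra | right; rewrite oppr0].
      by have -> : y1 = 0; [nra | right; rewrite oppr0].
    case: e => -[e1 e2]; first by rewrite -e1 -e2.
    by have := admissible_oppl adm; rewrite {1}e1 {1}e2 !opprK.
  have e : x2 = `|x2| /\ y2 = - `|y2| \/ x2 = - `|x2| /\ y2 = `|y2|.
    case: (ger0P x2) => ?; case: (ger0P y2) => ?; rewrite ?opprK; try by [left | right].
      by have [->|->] : x2 = 0 \/ y2 = 0; [nra | right; rewrite oppr0 | left; rewrite oppr0].
    nra.
  case: e => -[e1 e2]; first by rewrite -e1 -e2.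
  by have := admissible_oppr adm; rewrite {1}e1 {1}e2 !opprK.
rewrite -!normrM.
have h : 0 <= (x1 * y2) * - (y1 * x2) by have := mulr_ge0 p1 (_ : 0 <= - (x2 * y2)); nra.
rewrite -[`|x2 * y1|]normrN [x2 * y1]mulrC.
move: (x1 * y2) (- (y1 * x2)) h => u v h.
by case: (ger0P u) => ?; case: (ger0P v) => ?; case: (ger0P (u + v)) => ?; nra.
Qed.

(** Both vectors lie in the open quadrant I or both in III; negating them reduces III to I. *)
Lemma ssn_lt_addsame x y x' y' : 0 < x * y -> 0 < x' * y' -> 0 < x * x' ->
  F (x, y) < F (x + x', y + y').
Proof.
wlog x0 : x y x' y' / 0 < x => [wl h1 h2 h3|h1 h2 h3].
  have [x0|x0|x0] := ltgtP x 0; [|exact: wl|by rewrite x0 mul0r ltxx in h1].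
  rewrite -(ssnNl hF x) -(ssnNr hF _ y) -(ssnNl hF (x + _)) -(ssnNr hF _ (y + _)).
  by rewrite !opprD; apply: wl; rewrite ?mulrNN// oppr_gt0.
by apply: ssn_lt_addpos => //; nra.
Qed.

(** Not all of P, Q, P + Q lie in the open quadrants I and III up to a common reflection. Any two of
    them, with suitable signs, again have a unit sum and the same area, so a pair with opposite sign
    types can be selected. *)
Lemma hexagon_opposite_basis (P Q : R * R) : F P = 1 -> F Q = 1 -> F (P + Q) = 1 ->
  exists x1 y1 x2 y2, [/\ [/\ 0 <= x1, 0 <= y1, 0 <= x2 & 0 <= y2],
    admissible_basis x1 y1 x2 (- y2) & x1 * y2 + x2 * y1 = parallelogram_area P Q].
Proof.
case: P Q => [x1 y1] [x2 y2] F1 F2 F3.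
have {}F3 : F (x1 + x2, y1 + y2) = 1 := F3.
rewrite /parallelogram_area /=.
suff [a [b [c [d [adm p1 p2 e]]]]] : exists a b c d, [/\ admissible_basis a b c d,
    0 <= a * b, c * d <= 0 & `|a * d - b * c| = `|x1 * y2 - y1 * x2| ].
  have [adm' e'] := admissible_opposite_signs adm p1 p2.
  by exists `|a|, `|b|, `|c|, `|d|; split=> //; rewrite e'.
wlog p1 : y1 y2 F1 F2 F3 / 0 <= x1 * y1 => [wl|].
  have [|p1] := leP 0 (x1 * y1); first exact: wl.
  have [||||a [b [c [d [adm h1 h2 h3]]]]] := wl (- y1) (- y2).
  - by rewrite (ssnNr hF).
  - by rewrite (ssnNr hF).
  - by rewrite -opprD (ssnNr hF).
  - by rewrite mulrN oppr_ge0 ltW.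
  exists a, b, c, d; split=> //; rewrite h3 -[RHS]normrN; congr `|_|; ring.
have adm := hexagon_admissible F1 F2 F3.
have [p2|p2] := leP (x2 * y2) 0; first by exists x1, y1, x2, y2.
have [p3|p3] := leP ((x1 + x2) * (y1 + y2)) 0.
  exists x1, y1, (- (x1 + x2)), (- (y1 + y2)); split=> //.
  - apply: hexagon_admissible; rewrite ?(ssnNl hF) ?(ssnNr hF)//.
    by rewrite !opprD !addNKr (ssnNl hF) (ssnNr hF).
  - by rewrite mulrNN.
  - rewrite -[RHS]normrN; congr `|_|; ring.
have [p10|p10] := leP (x1 * y1) 0.
  exists x2, y2, x1, y1; split=> //; [|exact: ltW|].
    by apply: hexagon_admissible => //; rewrite addrC [y2 + _]addrC.
  rewrite -[RHS]normrN; congr `|_|; ring.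
(* All three products are positive. According to the signs, P + Q, P or Q is the sum of two unit
   vectors from one open quadrant, hence has norm greater than 1. *)
exfalso.
have [x12|x12] := ltP 0 (x1 * x2).
  by have := ssn_lt_addsame p10 p2 x12; rewrite F1 F3 ltxx.
have {}x12 : x1 * x2 < 0.
  rewrite lt_neqAle x12 andbT mulf_eq0; apply/norP; split.
    by apply: contraTneq p10 => ->; rewrite mul0r ltxx.
  by apply: contraTneq p2 => ->; rewrite mul0r ltxx.
have [h|h] := ltP 0 ((x1 + x2) * x1).
  have := @ssn_lt_addsame (x1 + x2) (y1 + y2) (- x2) (- y2) p3.
  rewrite mulrNN !addrK F1 F3 ltxx => /(_ p2) H.
  suff: false by []; apply: H; nra.
have := @ssn_lt_addsame (x1 + x2) (y1 + y2) (- x1) (- y1) p3.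
rewrite mulrNN ![_ + _ - _]addrAC !subrr !add0r F2 F3 ltxx => /(_ p10) H.
suff: false by []; apply: H.
have s0 : x1 + x2 != 0 by apply: contraTneq p3 => ->; rewrite mul0r ltxx.
have x10 : x1 != 0 by apply: contraTneq p10 => ->; rewrite mul0r ltxx.
rewrite mulrN oppr_gt0 lt_neqAle h andbT mulf_eq0; exact/norP.
Qed.

End Lattices.

(** * Almost critical lattices stable under perturbation *)

Section Porosity.
Variables (R : realType) (F : R * R -> R).
Hypothesis hF : strongly_symmetric_norm F.

Lemma dist_shift_le (s x u : R) : `|x + s - u| < s -> `|x - u| <= 2 * s.
Proof. by rewrite ltr_norml ler_norml => /andP[? ?]; apply/andP; split; lra. Qed.

(** Each basis vector moves by at most 4e in norm, so a lattice vector of norm N loses at most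
    4e(|m| + |n|) <= 12eN. *)
Lemma admissible_perturb (e x1 y1 x2 y2 u1 v1 u2 v2 : R) (m n : int) :
  admissible_basis F x1 y1 x2 y2 -> 0 <= e -> 12 * e <= 1 ->
  `|x1 - u1| <= 2 * e -> `|y1 - v1| <= 2 * e ->
  `|x2 - u2| <= 2 * e -> `|y2 - v2| <= 2 * e -> ~ (m = 0 /\ n = 0) ->
  1 - 12 * e <= F (m%:~R * u1 + n%:~R * u2, m%:~R * v1 + n%:~R * v2).
Proof.
move=> adm e0 e1 hx1 hy1 hx2 hy2 /adm[/=].
set N := F _; set N' := F _; set M := `|m%:~R| + `|n%:~R| => N1 MN.
have : N - N' <= 4 * e * M.
  apply: le_trans (ssn_triangleB hF _ _ _ _) _.
  have -> : m%:~R * x1 + n%:~R * x2 - (m%:~R * u1 + n%:~R * u2) =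
    m%:~R * (x1 - u1) + n%:~R * (x2 - u2) by ring.
  have -> : m%:~R * y1 + n%:~R * y2 - (m%:~R * v1 + n%:~R * v2) =
    m%:~R * (y1 - v1) + n%:~R * (y2 - v2) by ring.
  apply: le_trans (ssn_triangle hF _ _ _ _) _; rewrite !(ssnZ hF).
  have h1 : F (x1 - u1, y1 - v1) <= 4 * e by apply: le_trans (ssn_le_sum hF _ _) _; lra.
  have h2 : F (x2 - u2, y2 - v2) <= 4 * e by apply: le_trans (ssn_le_sum hF _ _) _; lra.
  rewrite [leRHS]mulrC mulrDl; apply: lerD; exact: ler_wpM2l.
have M0 : 0 <= M by rewrite addr_ge0.
nra.
Qed.

(* A lattice of covolume 1 with a basis of this shape is determined by the
   abscissa X of the second vector, the ratio r of the abscissas, and th. *)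
Definition robustly_avoids (c X r0 th0 e : R) := forall r th : R,
  `|r - r0| <= e -> `|th - th0| <= e ->
  [/\ 0 < r, 0 < th < 1 & forall m n : int, ~ (m = 0 /\ n = 0) ->
   c <= Delta F * F (m%:~R * (X * r) + n%:~R * X,
                     m%:~R * (th / X) + n%:~R * - ((1 - th) / (X * r))) ^+ 2].

(** A basis from a parallelogram of area below Delta/c is shifted by [s] into the open quadrants and
    scaled to covolume 1; continuity gives a neighbourhood of parameters. *)
Lemma robust_almost_critical_lattice (c : R) : 0 < c -> c < 1 ->
  exists X r0 th0 e : R, [/\ 0 < X, 0 < r0, 0 < th0 < 1, 0 < e &
    robustly_avoids c X r0 th0 e].
Proof.
move=> c0 c1; have D0 := Delta_gt0 hF.
have [P [Q [FP FQ FS]]] : exists P Q : R * R,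
  [/\ F P = 1, F Q = 1, F (P + Q) = 1 & parallelogram_area P Q < Delta F / c].
  by apply: (Delta_lt hF); rewrite ltr_pdivlMr// gtr_pMr.
have [x1 [y1 [x2 [y2 [[x10 y10 x20 y20] adm <-]]]]] := hexagon_opposite_basis hF FP FQ FS.
rewrite ltr_pdivlMr// => area_lt.
pose K := x1 + x2 + y1 + y2 + 2.
have K0 : 2 <= K by rewrite /K; lra.
(* Since D <= A + sK for the old area A, and (1 - 12s)^2 >= 1 - 24s, this choice yields cD <= Delta
   (1 - 12s)^2. *)
pose s := Num.min (1 / 24) ((Delta F - (x1 * y2 + x2 * y1) * c) / (24 * Delta F + c * K)).
have den0 : 0 < 24 * Delta F + c * K by nra.
have s0 : 0 < s by rewrite lt_min; apply/andP; split; [lra | rewrite divr_gt0// subr_gt0].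
have s24 : s <= 1 / 24 by rewrite ge_min lexx.
have s12 : 12 * s <= 1 by lra.
have sD : s * (24 * Delta F + c * K) <= Delta F - (x1 * y2 + x2 * y1) * c.
  by rewrite -ler_pdivlMr// ge_min lexx orbT.
pose X1 := x1 + s; pose Y1 := y1 + s; pose X2 := x2 + s; pose Y2 := y2 + s.
have X10 : 0 < X1 by rewrite /X1; lra.
have Y10 : 0 < Y1 by rewrite /Y1; lra.
have X20 : 0 < X2 by rewrite /X2; lra.
have Y20 : 0 < Y2 by rewrite /Y2; lra.
pose D := X1 * Y2 + X2 * Y1.
have DD0 : 0 < D by rewrite addr_gt0// mulr_gt0.
have Dle : c * D <= Delta F * (1 - 12 * s) ^+ 2.
  have : D <= x1 * y2 + x2 * y1 + s * K by rewrite /D /X1 /Y1 /X2 /Y2 /K; nra.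
  move=> h; have : c * D <= c * (x1 * y2 + x2 * y1 + s * K) by rewrite ler_pM2l.
  have : Delta F * (1 - 24 * s) <= Delta F * (1 - 12 * s) ^+ 2 by rewrite ler_pM2l//; nra.
  lra.
(* With [th0] the share of X2 Y1 in D, one has X1 = X2 r0, Y1 = D th0 / X2 and Y2 = D (1 - th0) /
   (X2 r0). *)
pose r0 := X1 / X2; pose th0 := X2 * Y1 / D.
have r00 : 0 < r0 by rewrite divr_gt0.
have th00 : 0 < th0 by rewrite divr_gt0// mulr_gt0.
have th01 : th0 < 1 by rewrite ltr_pdivrMr// mul1r /D ltrDr mulr_gt0.
have cf : {for (r0, th0), continuous (fun z : R * R => z.1)} by exact: cvg_fst.
have cs : {for (r0, th0), continuous (fun z : R * R => z.2)} by exact: cvg_snd.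
have n1 : \forall z \near ((r0, th0) : R * R), `|X1 - X2 * z.1| < s.
  have h : (X2 * z.1 : R) @[z --> ((r0, th0) : R * R)] --> X1.
    have -> : X1 = X2 * r0 by rewrite /r0 mulrC divfK// lt0r_neq0.
    by apply: cvgM; [exact: cvg_cst | exact: cf].
  exact: (cvgr_dist_lt _ _ h).
have n2 : \forall z \near ((r0, th0) : R * R), `|Y1 - D * z.2 / X2| < s.
  have h : (D * z.2 / X2 : R) @[z --> ((r0, th0) : R * R)] --> Y1.
    have -> : Y1 = D * th0 / X2 by rewrite /th0; field; rewrite !lt0r_neq0.
    by apply: cvgM; [apply: cvgM; [exact: cvg_cst | exact: cs] | exact: cvg_cst].
  exact: (cvgr_dist_lt _ _ h).
have n3 : \forall z \near ((r0, th0) : R * R), `|Y2 - D * (1 - z.2) / (X2 * z.1)| < s.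
  have h : (D * (1 - z.2) / (X2 * z.1) : R) @[z --> ((r0, th0) : R * R)] --> Y2.
    have -> : Y2 = D * (1 - th0) / (X2 * r0).
      have -> : 1 - th0 = X1 * Y2 / D by rewrite /th0 /D; field; rewrite lt0r_neq0.
      by rewrite /r0; field; rewrite !lt0r_neq0.
    apply: cvgM.
      by apply: cvgM; [exact: cvg_cst | apply: cvgB; [exact: cvg_cst | exact: cs]].
    apply: cvgV; first by rewrite lt0r_neq0// mulr_gt0.
    by apply: cvgM; [exact: cvg_cst | exact: cf].
  exact: (cvgr_dist_lt _ _ h).
have n4 : \forall z \near ((r0, th0) : R * R), 0 < z.1.
  exact: (@cvgr_gt _ _ _ _ (fun z : R * R => z.1) r0 cf).
have n5 : \forall z \near ((r0, th0) : R * R), 0 < z.2.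
  exact: (@cvgr_gt _ _ _ _ (fun z : R * R => z.2) th0 cs).
have n6 : \forall z \near ((r0, th0) : R * R), z.2 < 1.
  exact: (@cvgr_lt _ _ _ _ (fun z : R * R => z.2) th0 cs).
have : \forall z \near ((r0, th0) : R * R), [/\ `|X1 - X2 * z.1| < s,
   `|Y1 - D * z.2 / X2| < s, `|Y2 - D * (1 - z.2) / (X2 * z.1)| < s,
   0 < z.1 & 0 < z.2 < 1].
  by near=> z; split; [near: z; exact: n1|near: z; exact: n2|near: z; exact: n3|
    near: z; exact: n4|apply/andP; split; near: z; [exact: n5|exact: n6]].
move=> /nbhs_ballP[e /= e0 he].
pose l := Num.sqrt D; have l0 : 0 < l by rewrite sqrtr_gt0.
have lD : l ^+ 2 = D by rewrite sqr_sqrtr// ltW.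
exists (X2 / l), r0, th0, (e / 2); split=> //; [exact: divr_gt0|by rewrite th00|exact: divr_gt0|].
move=> r th hr hth.
have [h1 h2 h3 r1 th1] : [/\ `|X1 - X2 * r| < s, `|Y1 - D * th / X2| < s,
   `|Y2 - D * (1 - th) / (X2 * r)| < s, 0 < r & 0 < th < 1].
  have e2 : e / 2 < e by rewrite ltr_pdivrMr// ltr_pMr// ltr1n.
  by apply: (he (r, th)); split; rewrite /ball /= distrC;
    [exact: le_lt_trans hr e2 | exact: le_lt_trans hth e2].
split=> // m n mn0.
have h4 : `|x2 - X2| <= 2 * s by apply: dist_shift_le; rewrite subrr normr0.
have h3' : `|- y2 - - (D * (1 - th) / (X2 * r))| <= 2 * s.
  by rewrite opprK addrC distrC; exact: dist_shift_le h3.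
have := admissible_perturb adm (ltW s0) _ (dist_shift_le h1) (dist_shift_le h2) h4 h3' mn0.
have -> : m%:~R * (X2 * r) + n%:~R * X2 = l * (m%:~R * (X2 / l * r) + n%:~R * (X2 / l)).
  by field; rewrite lt0r_neq0.
have -> : m%:~R * (D * th / X2) + n%:~R * - (D * (1 - th) / (X2 * r)) =
   l * (m%:~R * (th / (X2 / l)) + n%:~R * - ((1 - th) / (X2 / l * r))).
  by rewrite -lD; field; rewrite !lt0r_neq0.
rewrite (ssnZ hF) gtr0_norm//; set N := F _ => /(_ s12) hN.
have : (1 - 12 * s) ^+ 2 <= (l * N) ^+ 2.
  by rewrite ler_pXn2r ?nnegrE ?mulr_ge0 ?(ltW l0) ?(ssn_ge0 hF)// subr_ge0.
rewrite exprMn lD => hN2.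
have : c * D <= Delta F * (D * N ^+ 2).
  by apply: le_trans Dle _; rewrite ler_pM2l.
by rewrite mulrCA mulrC ler_pM2l.
Unshelve. all: by end_near. Qed.

(** The fraction (aN + 1)/N^2 is close to r, and (aN + 1)(1 - aN) + a^2 N^2 = 1 completes it by the
    pair (-a^2, 1 - aN). Adding [k] times the first pair makes the second positive and keeps its
    ratio close to r. *)
Lemma unimodular_near_ratio (r e : R) : 0 < r -> 0 < e ->
  exists m n m' n' : int, [/\ 0 < m, 0 < n, 0 < m' & 0 < n'] /\
   [/\ m * n' - n * m' = 1,
    `|m%:~R - r * m'%:~R| <= e * m'%:~R & `|n%:~R - r * n'%:~R| <= e * n'%:~R].
Proof.
move=> r0 e0.
pose N := (Num.truncn (3 / e)).+1.
have NE : 3 <= e * N%:R.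
  by rewrite mulrC -ler_pdivrMr//; apply/ltW/truncnS_gt.
pose a := Num.truncn (r * N%:R).
have /andP[a1 a2] : a%:R <= r * N%:R < a.+1%:R by apply: truncn_itv; rewrite mulr_ge0// ltW.
pose k := (a ^ 2 + a + 1)%N.
pose m := (a * N + 1)%:Z; pose m' := (N ^ 2)%:Z.
pose n := k%:Z * m - (a ^ 2)%:Z; pose n' := k%:Z * m' + 1 - (a * N)%:Z.
have N1 : (1 <= N)%N by [].
exists m, n, m', n'; split.
  by rewrite /n /n' /m /m' /k; split; nia.
have mE : m%:~R = a%:R * N%:R + 1 :> R.
  by rewrite -[LHS]/((a * N + 1)%:R) natrD natrM.
have m'E : m'%:~R = N%:R ^+ 2 :> R by rewrite -[LHS]/((N ^ 2)%:R) natrX.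
have NR : 1 <= N%:R :> R by rewrite ler1n.
rewrite -natr1 in a2.
have hm : `|m%:~R - r * m'%:~R| <= N%:R.
  by rewrite mE m'E ler_norml; apply/andP; split; nra.
have n'1 : 1 <= n'%:~R :> R.
  by rewrite -[1]/(1%:~R) ler_int /n' /m' /k; nia.
have detZ : m * n' - n * m' = 1 by rewrite /n /n' /m /m'; nia.
have det : m%:~R * n'%:~R - n%:~R * m'%:~R = 1 :> R.
  by move: detZ => /(congr1 (fun z : int => z%:~R : R)); rewrite rmorphB !rmorphM.
split; [exact: detZ | by apply: le_trans hm _; rewrite m'E; nra|].
have m'0 : 0 < m'%:~R :> R by rewrite m'E; nra.
rewrite -(ler_pM2l m'0) -[m'%:~R in leLHS]gtr0_norm// -normrM.
have -> : m'%:~R * (n%:~R - r * n'%:~R) = (m%:~R - r * m'%:~R) * n'%:~R - 1.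
  by lra.
apply: le_trans (ler_normB _ _) _; rewrite normr1 normrM [`|n'%:~R|]ger0_norm; last by lra.
apply: (@le_trans _ _ (N%:R * n'%:~R + 1)); first by rewrite lerD2r ler_wpM2r//; lra.
rewrite m'E.
have h : 3 * (N%:R * n'%:~R) <= e * N%:R * (N%:R * n'%:~R) by rewrite ler_wpM2r// mulr_ge0//; lra.
nra.
Qed.

End Porosity.

(** * Porosity of the improvable numbers *)

(** Almost every point of A is a density point, but the holes keep the relative measure at most 1 -
    kappa in arbitrarily small balls about each irrational point of A. The rationals form a null
    set. *)
Lemma porous_negligible (R : realType) (A : set R) (kappa : R) :
  closed A -> 0 < kappa ->
  (forall x, irrational x -> A x -> forall r0, 0 < r0 ->
    exists r b, [/\ 0 < r < r0, ball b (kappa * r) `<=` ball x r &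
                 ball b (kappa * r) `<=` ~` A]) ->
  (@lebesgue_measure R).-negligible A.
Proof.
move=> clA k0 porous.
have mA : measurable A by exact: closed_measurable.
have dens := lebesgue_density mA.
have neglQ : (@lebesgue_measure R).-negligible (@rational R).
  apply/negligibleP; last exact: lebesgue_measure_rat.
  apply: countable_measurable => [r|]; first exact: measurable_set1.
  by apply: sub_countable (card_image_le _ _) (countableP _).
apply: negligibleS (negligibleU neglQ dens).
move=> x Ax; have [|ix] := pselect (rational x); [by left | right => /= cvx].
have {}cvx : (lebesgue_measure (A `&` ball x r) * (lebesgue_measure (ball x r))^-1)%E
    @[r --> 0^'+] --> 1%:E.
  by move: cvx; rewrite indicE mem_set.
have /= [r0 r00 hr0] : \forall r \near 0^'+,
    ((1 - kappa)%:E < lebesgue_measure (A `&` ball x r) * (lebesgue_measure (ball x r))^-1)%E.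
  apply: (cvx [set u | ((1 - kappa)%:E < u)%E]); apply: open_nbhs_nbhs; split.
    exact: open_ereal_gt_ereal.
  by rewrite /= lte_fin ltrBlDr ltrDl.
have [r [b [/andP[r1 r2] bx bA]]] := porous x ix Ax r0 r00.
have := hr0 r; rewrite /= sub0r normrN gtr0_norm// => /(_ r2 r1).
apply/negP; rewrite -leNgt (lebesgue_measure_ball _ (ltW r1)).
have kr : 0 < kappa * r by rewrite mulr_gt0.
have : (lebesgue_measure (A `&` ball x r) <= (r *+ 2)%:E - (kappa * r *+ 2)%:E)%E.
  rewrite -(lebesgue_measure_ball x (ltW r1)) -(lebesgue_measure_ball b (ltW kr)).
  rewrite -(setIidr bx) -measureD//; last 3 first.
  - exact: measurable_ball.
  - exact: measurable_ball.
  - by rewrite -[ltLHS]/(lebesgue_measure (ball x r)) (lebesgue_measure_ball _ (ltW r1)) ltry.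
  apply: le_measure; rewrite ?inE.
  - by apply: measurableI => //; exact: measurable_ball.
  - by apply: measurableD; exact: measurable_ball.
  - by move=> y [Ay xy]; split=> // /bA.
rewrite inver; have r20 : r *+ 2 != 0 by rewrite mulrn_eq0/= gt_eqF.
rewrite (negbTE r20) => h.
apply: (@le_trans _ _ (((r *+ 2)%:E - (kappa * r *+ 2)%:E) * ((r *+ 2)^-1)%:E)%E).
  by rewrite lee_wpmul2r// lee_fin invr_ge0 mulrn_wge0// ltW.
rewrite -EFinB -EFinM lee_fin !mulr2n.
suff -> : (r + r - (kappa * r + kappa * r)) / (r + r) = 1 - kappa by [].
by field; rewrite -mulr2n.
Qed.

(** * Bad intervals in Farey cylinders and measure zero *)

Section Null.
Variables (R : realType) (F : R * R -> R).
Hypothesis hF : strongly_symmetric_norm F.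

(** Cramer's rule writes (q, p) with integer coefficients u, v in the basis (x1, p1), (x2, p2). At t
    = x2/X the scaled lattice has the shape in [robustly_avoids] with r = x1/x2, up to a sign in the
    second coordinate. *)
Lemma not_approximable_basis (c X r0 th0 e beta : R) (x1 x2 p1 p2 : int) (sg : bool) :
  0 < X ->
  robustly_avoids F c X r0 th0 e ->
  0 < x1 -> 0 < x2 -> x1 * p2 - x2 * p1 = (-1) ^+ sg ->
  `|x1%:~R - r0 * x2%:~R| <= e * x2%:~R ->
  `|x2%:~R * ((-1) ^+ sg * (x1%:~R * beta - p1%:~R)) - th0| <= e ->
  ~ approximable F beta c (x2%:~R / X).
Proof.
move=> X0 robust x10 x20 det hr hth [p [q [q0]]].
apply/negP; rewrite -leNgt.
have x1R : 0 < x1%:~R :> R by rewrite ltr0z.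
have x2R : 0 < x2%:~R :> R by rewrite ltr0z.
pose sR : R := (-1) ^+ sg.
have s2 : sR * sR = 1 by rewrite -expr2 sqrr_sign.
have detR : x1%:~R * p2%:~R - x2%:~R * p1%:~R = sR.
  have := congr1 (fun z : int => z%:~R : R) det.
  by rewrite rmorphB !rmorphM /= rmorphXn.
set th := _ * (_ * _) in hth.
have hr' : `|x1%:~R / x2%:~R - r0| <= e.
  have -> : x1%:~R / x2%:~R - r0 = (x1%:~R - r0 * x2%:~R) / x2%:~R.
    by field; rewrite lt0r_neq0.
  by rewrite normrM normfV (gtr0_norm x2R) ler_pdivrMr.
have [_ _ bound] := robust _ _ hr' hth.
pose u := (-1) ^+ sg * (q * p2 - p * x2); pose v := (-1) ^+ sg * (x1 * p - p1 * q).
have sZ : (-1) ^+ sg * (-1) ^+ sg = 1 :> int by rewrite -expr2 sqrr_sign.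
have qE : q = u * x1 + v * x2.
  have -> : u * x1 + v * x2 = (-1) ^+ sg * (x1 * p2 - x2 * p1) * q by rewrite /u /v; ring.
  by rewrite det sZ mul1r.
have pE : p = u * p1 + v * p2.
  have -> : u * p1 + v * p2 = (-1) ^+ sg * (x1 * p2 - x2 * p1) * p by rewrite /u /v; ring.
  by rewrite det sZ mul1r.
have uv0 : ~ (u = 0 /\ v = 0) by move=> [u0 v0]; rewrite qE u0 v0 !mul0r addr0 ltxx in q0.
have := bound u v uv0.
rewrite /scaled_norm /=.
have -> : u%:~R * (X * (x1%:~R / x2%:~R)) + v%:~R * X = (x2%:~R / X)^-1 * q%:~R.
  by rewrite [in RHS]qE rmorphD !rmorphM /=; field; rewrite !lt0r_neq0.
set y := (Y in F (_, Y)); set y' := (Y in _ -> is_true (_ <= _ * F (_, Y) ^+ 2)).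
have -> : y = - sR * y'.
  rewrite /y /y' [in RHS]qE [in RHS]pE !rmorphD !rmorphM /=.
  have -> : (1 - th) / (X * (x1%:~R / x2%:~R)) = - (x2%:~R / X * (sR * (x2%:~R * beta - p2%:~R))).
    have -> : 1 - th = - x1%:~R * (sR * (x2%:~R * beta - p2%:~R)).
      have e1 : sR * (x1%:~R * p2%:~R - x2%:~R * p1%:~R) = 1 by rewrite detR.
      by rewrite /th -/sR; lra.
    by field; rewrite !lt0r_neq0.
  by rewrite /th -/sR; field; rewrite !lt0r_neq0.
rewrite /sR; case: (sg); rewrite ?expr0 ?expr1 ?opprK ?mul1r// mulN1r.
by rewrite (ssnNr hF).
Qed.

(* The cylinder of the Farey pair p/q, p'/q' is described by h > 0 and h' > 0; the
   basis change (m, n; m', n') has positive entries, so b stays inside it. *)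
Lemma farey_bad_interval (c X r0 th0 e alpha : R) (m n m' n' p q p' q' : int) (sg : bool) :
  0 < X -> 0 < th0 < 1 -> 0 < e -> robustly_avoids F c X r0 th0 e ->
  [/\ 0 < m, 0 < n, 0 < m' & 0 < n'] -> m * n' - n * m' = 1 ->
  `|m%:~R - r0 * m'%:~R| <= e * m'%:~R -> `|n%:~R - r0 * n'%:~R| <= e * n'%:~R ->
  1 <= q -> q <= q' <= 2 * q -> p' * q - p * q' = (-1) ^+ sg ->
  0 < (-1) ^+ sg * (q%:~R * alpha - p%:~R) ->
  0 < - ((-1) ^+ sg * (q'%:~R * alpha - p'%:~R)) ->
  exists b t : R, [/\ q%:~R / X <= t, `|b - alpha| < (q%:~R ^+ 2)^-1 &
    forall beta : R,
      `|beta - b| < e / ((m + 2 * n)%:~R * (m' + 2 * n')%:~R) / q%:~R ^+ 2 ->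
      ~ approximable F beta c t].
Proof.
move=> X0 /andP[th00 th01] e0 robust [m0 n0 m'0 n'0] detM hm hn q1 qq' det ha ha'.
pose sR : R := (-1) ^+ sg.
have s2 : sR * sR = 1 by rewrite -expr2 sqrr_sign.
set C : R := (m + 2 * n)%:~R * (m' + 2 * n')%:~R.
have C0 : 0 < C by rewrite mulr_gt0// ltr0z; clear - m0 n0 m'0 n'0; lia.
pose h beta := sR * (q%:~R * beta - p%:~R).
pose h' beta := - (sR * (q'%:~R * beta - p'%:~R)).
have hh' beta : q'%:~R * h beta + q%:~R * h' beta = 1.
  have := congr1 (fun z : int => z%:~R : R) det.
  rewrite rmorphB !rmorphM /= rmorphXn /= -[(- 1) ^+ sg]/sR => d.
  have e1 := s2; rewrite -{2}d in e1.
  by rewrite /h /h'; lra.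
have qR : 1 <= q%:~R :> R by rewrite -[1]/(1%:~R) ler_int.
have q'R : q%:~R <= q'%:~R :> R by rewrite ler_int; case/andP: qq'.
(* The basis change keeps the determinant, and x1/x2 is close to [r0] because m/m' and n/n' both
   are. *)
pose x1 := m * q + n * q'; pose x2 := m' * q + n' * q'.
pose p1 := m * p + n * p'; pose p2 := m' * p + n' * p'.
have x12 : [/\ 0 < x1, 0 < x2 & q <= x2].
  by rewrite /x1 /x2; split; clear - m0 n0 m'0 n'0 q1 qq'; nia.
have [x10 x20 qx2] := x12.
have x1R : 0 < x1%:~R :> R by rewrite ltr0z.
have x2R : 0 < x2%:~R :> R by rewrite ltr0z.
(* The bound q' <= 2q makes the bad interval proportional to 1/q^2. *)
have x12C : x1%:~R * x2%:~R <= C * q%:~R ^+ 2.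
  have -> : C * q%:~R ^+ 2 = ((m + 2 * n) * q)%:~R * ((m' + 2 * n') * q)%:~R.
    by rewrite /C !rmorphM /=; ring.
  have [le1 le2] : x1 <= (m + 2 * n) * q /\ x2 <= (m' + 2 * n') * q.
    by rewrite /x1 /x2; split; clear - m0 n0 m'0 n'0 q1 qq'; nia.
  by apply: ler_pM; rewrite ?ler_int// ltW.
have detx : x1 * p2 - x2 * p1 = (-1) ^+ sg.
  have -> : x1 * p2 - x2 * p1 = (m * n' - n * m') * (p' * q - p * q').
    by rewrite /x1 /x2 /p1 /p2; ring.
  by rewrite detM mul1r.
have ratio : `|x1%:~R - r0 * x2%:~R| <= e * x2%:~R.
  have -> : x1%:~R - r0 * x2%:~R =
    (m%:~R - r0 * m'%:~R) * q%:~R + (n%:~R - r0 * n'%:~R) * q'%:~R :> R.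
    by rewrite /x1 /x2 !rmorphD !rmorphM /=; ring.
  apply: le_trans (ler_normD _ _) _; rewrite !normrM.
  rewrite !(ger0_norm (_ : 0 <= _%:~R)); [|lra|lra].
  have -> : e * x2%:~R = e * m'%:~R * q%:~R + e * n'%:~R * q'%:~R.
    by rewrite /x2 !rmorphD !rmorphM /=; ring.
  by apply: lerD; apply: ler_wpM2r => //; lra.
(* This solves [th b] = [th0]; the slope of [th] is x1 x2 up to sign. *)
pose b := (p1%:~R + sR * th0 / x2%:~R) / x1%:~R.
pose th beta := x2%:~R * (sR * (x1%:~R * beta - p1%:~R)).
have thb : th b = th0.
  have -> : th b = sR * sR * th0 by rewrite /th /b; field; rewrite !lt0r_neq0.
  by rewrite s2 mul1r.
have thB beta : th beta - th0 = x1%:~R * x2%:~R * (sR * (beta - b)).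
  by rewrite -thb /th; ring.
have h1b : x2%:~R * (m%:~R * h b - n%:~R * h' b) = th0.
  by rewrite -thb /th /h /h' /x1 /p1 !rmorphD !rmorphM /=; ring.
have dM : m%:~R * n'%:~R - n%:~R * m'%:~R = 1 :> R.
  have := congr1 (fun z : int => z%:~R : R) detM.
  by rewrite rmorphB !rmorphM.
have h2b : x1%:~R * (n'%:~R * h' b - m'%:~R * h b) = 1 - th0.
  have : x2%:~R * (m%:~R * h b - n%:~R * h' b) + x1%:~R * (n'%:~R * h' b - m'%:~R * h b) =
    (m%:~R * n'%:~R - n%:~R * m'%:~R) * (q'%:~R * h b + q%:~R * h' b).
    by rewrite /x1 /x2 !rmorphD !rmorphM /=; ring.
  by rewrite dM hh' mulr1 h1b => /eqP; rewrite addrC eq_sym -subr_eq => /eqP <-.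
have h1p : 0 < m%:~R * h b - n%:~R * h' b by rewrite -(pmulr_rgt0 _ x2R) h1b.
have h2p : 0 < n'%:~R * h' b - m'%:~R * h b by rewrite -(pmulr_rgt0 _ x1R) h2b subr_gt0.
have hb : 0 < h b.
  (* Inverting the unimodular matrix writes [h b] as a positive combination of th0/x2 and (1 -
     th0)/x1. *)
  have e2 : (m%:~R * n'%:~R - n%:~R * m'%:~R) * h b = h b by rewrite dM mul1r.
  have -> : h b = n'%:~R * (m%:~R * h b - n%:~R * h' b) + n%:~R * (n'%:~R * h' b - m'%:~R * h b).
    by rewrite -[LHS]e2; ring.
  by rewrite addr_gt0// mulr_gt0// ltr0z.
have h'b : 0 < h' b.
  have e2 : (m%:~R * n'%:~R - n%:~R * m'%:~R) * h' b = h' b by rewrite dM mul1r.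
  have -> : h' b = m'%:~R * (m%:~R * h b - n%:~R * h' b) + m%:~R * (n'%:~R * h' b - m'%:~R * h b).
    by rewrite -[LHS]e2; ring.
  by rewrite addr_gt0// mulr_gt0// ltr0z.
have qn0 : q%:~R != 0 :> R by rewrite intr_eq0; clear - q1; lia.
have q2 : 0 < q%:~R ^+ 2 :> R by rewrite lt_neqAle sqr_ge0 andbT eq_sym expf_neq0.
have nsR (z : R) : `|sR * z| = `|z| by rewrite normrM normr_sign mul1r.
(* On the cylinder q'h lies in (0,1) and [h] has slope q up to sign, so qq'|b - alpha| < 1, with q'
   >= q. *)
have bdist : `|b - alpha| < (q%:~R ^+ 2)^-1.
  have cyl_lt1 (x : R) : 0 < h x -> 0 < h' x -> 0 < q'%:~R * h x < 1.
    have q0 : 0 < q%:~R :> R by exact: lt_le_trans ltr01 qR.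
    move=> hx h'x; apply/andP; split; first exact: mulr_gt0 (lt_le_trans q0 q'R) hx.
    by rewrite -[ltRHS](hh' x) ltrDl; exact: mulr_gt0.
  have hB : h b - h alpha = sR * (q%:~R * (b - alpha)) by rewrite /h; ring.
  have : `|q'%:~R * (h b - h alpha)| < 1.
    have /andP[u0 u1] := cyl_lt1 _ hb h'b; have /andP[v0 v1] := cyl_lt1 _ ha ha'.
    rewrite mulrBr ltr_norml; clear - u0 u1 v0 v1.
    by apply/andP; split; lra.
  have qq0 : 0 <= q'%:~R * q%:~R :> R by rewrite -rmorphM ler0z; clear - q1 qq'; nia.
  rewrite hB mulrCA nsR mulrA normrM (ger0_norm qq0) => hlt.
  rewrite -[ltRHS]mul1r ltr_pdivlMr// mulrC; apply: le_lt_trans hlt.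
  by rewrite ler_wpM2r// expr2 ler_wpM2r// ler0z; clear - q1; lia.
exists b, (x2%:~R / X); split=> //; first by rewrite ler_pM2r ?invr_gt0// ler_int.
move=> beta bb.
apply: (not_approximable_basis X0 robust x10 x20 detx ratio).
rewrite -/(th beta) thB normrM nsR ger0_norm; last by rewrite mulr_ge0// ltW.
apply: (@le_trans _ _ (C * q%:~R ^+ 2 * (e / C / q%:~R ^+ 2))); last first.
  have -> // : C * q%:~R ^+ 2 * (e / C / q%:~R ^+ 2) = e.
    by field; rewrite ?(lt0r_neq0 C0) ?qn0.
by apply: ler_pM => //; [rewrite mulr_ge0// ltW | exact: ltW].
Qed.

(** With r = 2/q^2, the bad ball has radius kappa r = e/(C q^2) <= 1/q^2 and its centre is within
    1/q^2 of alpha. A large q makes r small and the failing t large. *)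
Lemma improvable_porous (c : R) : 0 < c -> c < 1 -> exists2 kappa : R, 0 < kappa &
  forall alpha, irrational alpha -> forall T r0, 0 < r0 ->
  exists r b, [/\ 0 < r < r0, ball b (kappa * r) `<=` ball alpha r &
    forall beta, ball b (kappa * r) beta -> exists2 t, T < t & ~ approximable F beta c t].
Proof.
move=> c0 c1.
have [X [r0 [th0 [e [X0 r00 th001 e0 robust]]]]] := robust_almost_critical_lattice hF c0 c1.
have e1 : e < 1.
  have [||_ /andP[_ h] _] := robust r0 (th0 + e).
  - by rewrite subrr normr0 ltW.
  - by rewrite addrAC subrr add0r ger0_norm// ltW.
  - by case/andP: th001; lra.
have [m [n [m' [n' [pos [detM hm hn]]]]]] := unimodular_near_ratio r00 e0.
pose C : R := (m + 2 * n)%:~R * (m' + 2 * n')%:~R.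
have C1 : 1 <= C.
  have [m0 n0 m'0 n'0] := pos.
  have h1 : 1 <= (m + 2 * n)%:~R :> R by rewrite -[1]/(1%:~R) ler_int; clear - m0 n0; lia.
  have h2 : 1 <= (m' + 2 * n')%:~R :> R by rewrite -[1]/(1%:~R) ler_int; clear - m'0 n'0; lia.
  exact: mulr_ege1.
have C0 : 0 < C by lra.
exists (e / (2 * C)); first by rewrite divr_gt0//; lra.
move=> alpha /irrational_cf[a [k cfa]] T rho rho0.
have [N NT Nr] : exists2 N : nat, T * X < N%:R & 2 / rho < N%:R.
  exists (Num.truncn (Num.max (T * X) (2 / rho))).+1;
    by apply: le_lt_trans (truncnS_gt _); rewrite le_max lexx ?orbT.
pose q := cf_den a N.+1; pose p := cf_num a k N.+1.
have q1 : 1 <= q := cf_den_ge1 cfa N.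
have qN : N%:R <= q%:~R :> R by rewrite -[leLHS]/(N%:Z%:~R) ler_int (cf_den_ge cfa).
have [b [t [tq bdist hb]]] : exists b t : R, [/\ q%:~R / X <= t,
    `|b - alpha| < (q%:~R ^+ 2)^-1 &
    forall beta : R, `|beta - b| < e / C / q%:~R ^+ 2 -> ~ approximable F beta c t].
  (* The convergent is paired with its mediant with the preceding one: the denominator is at most 2q
     whatever the next digit, and decreasing errors put the mediant on the other side of alpha. *)
  apply: (@farey_bad_interval c X r0 th0 e alpha m n m' n' p q (p + cf_num a k N)
    (q + cf_den a N) (odd N)) => //.
  - by have := cf_den_ge0 a N; have := cf_den_le cfa N; rewrite -/q; clear; lia.
  - by rewrite signr_odd -(cf_det a k N) /p /q; ring.
  - suff <- : cf_err alpha a k N.+1 = (-1) ^+ odd N * (q%:~R * alpha - p%:~R) by exact: cfa.2.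
    by rewrite /cf_err signr_odd !exprS -/q -/p; ring.
  - have : 0 < cf_err alpha a k N - cf_err alpha a k N.+1 by rewrite subr_gt0 cf_err_decr.
    suff -> : cf_err alpha a k N - cf_err alpha a k N.+1 = - ((-1) ^+ odd N *
      ((q + cf_den a N)%:~R * alpha - (p + cf_num a k N)%:~R)) by [].
    by rewrite /cf_err signr_odd !exprS -/q -/p !rmorphD /=; ring.
have qR : 1 <= q%:~R :> R by rewrite -[1]/(1%:~R) ler_int.
have qn0 : q%:~R != 0 :> R by rewrite intr_eq0; clear - q1; lia.
have q2 : 0 < q%:~R ^+ 2 :> R by rewrite lt_neqAle sqr_ge0 andbT eq_sym expf_neq0.
have KE : e / (2 * C) * (2 / q%:~R ^+ 2) = e / C / q%:~R ^+ 2.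
  by field; rewrite ?(lt0r_neq0 C0) ?qn0.
exists (2 / q%:~R ^+ 2), b; rewrite KE; split.
- rewrite divr_gt0//= ltr_pdivrMr//.
  have : 2 < rho * q%:~R by rewrite mulrC -ltr_pdivrMr//; exact: lt_le_trans qN.
  move: (q%:~R) qR => z z1 h2; rewrite expr2 mulrA; nra.
- move=> beta; rewrite /ball /= => bb.
  have -> : alpha - beta = (b - beta) - (b - alpha) by ring.
  apply: le_lt_trans (ler_normB _ _) _.
  have : e / C / q%:~R ^+ 2 <= 1 / q%:~R ^+ 2.
    by rewrite ler_pM2r ?invr_gt0// ler_pdivrMr// mul1r; lra.
  move: bb bdist; rewrite mul1r; lra.
move=> beta; rewrite /ball /= distrC => /hb nb; exists t => //.
by apply: lt_le_trans tq; rewrite ltr_pdivlMr//; exact: lt_le_trans NT qN.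
Qed.

(** An improvable number avoids some [E j i], hence its interior. The complement of that interior is
    closed, and porous because the bad balls are open and lie in [E j i]. The shift [j.+2] keeps the
    constant in (0,1). *)
Lemma improvable_negligible : (@lebesgue_measure R).-negligible
  [set alpha : R | irrational alpha /\ delta F alpha < 1].
Proof.
pose E (j i : nat) := [set beta : R |
  exists2 t, i%:R < t & ~ approximable F beta (1 - j.+2%:R^-1) t].
have sub : [set alpha : R | irrational alpha /\ delta F alpha < 1] `<=`
    \bigcup_j \bigcup_i ~` interior (E j i).
  move=> alpha [ia /(delta_lt1P hF ia)[c c1 [M [_ hM]]]].
  exists (Num.truncn (1 - c)^-1) => //; exists (Num.truncn M).+1 => // /interior_subset.
  move=> [t Mt]; apply; apply: approximable_le (hM t _); last first.
    exact: lt_trans (truncnS_gt _) Mt.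
  have c0 : 0 < 1 - c by rewrite subr_gt0.
  rewrite lerBrDr addrC -lerBrDr -[leRHS]invrK lef_pV2 ?posrE ?invr_gt0// ?ltr0n//.
  by rewrite ltW// (lt_trans (truncnS_gt _))// ltr_nat.
suff : (@lebesgue_measure R).-negligible (\bigcup_j \bigcup_i ~` interior (E j i)).
  by move=> neg; apply: negligibleS neg; exact: sub.
apply: negligible_bigcup => j; apply: negligible_bigcup => i.
have j0 : 0 < j.+2%:R^-1 :> R by rewrite invr_gt0 ltr0n.
have j1 : j.+2%:R^-1 < 1 :> R by rewrite invf_lt1 ?ltr0n// ltr1n.
have [||kappa k0 por] := @improvable_porous (1 - j.+2%:R^-1).
- by rewrite subr_gt0.
- by rewrite gtrBl.
apply: (@porous_negligible _ _ kappa) => //.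
  by apply: open_closedC; exact: open_interior.
move=> x ix _ r0 r00; have [r [b [r1 bx hb]]] := por x ix i%:R r0 r00.
exists r, b; split=> //; rewrite setCK => beta bbeta.
have nb : nbhs beta (ball b (kappa * r)).
  by apply: open_nbhs_nbhs; split=> //; exact: ball_open.
exact: (@filterS _ (nbhs beta) _ _ _ hb nb).
Qed.

End Null.

Theorem theorem1 (R : realType) (F : R * R -> R)
  (hF : strongly_symmetric_norm F) :
  ~ countable [set alpha : R | irrational alpha /\ delta F alpha < 1] /\
  (@lebesgue_measure R).-negligible
    [set alpha : R | irrational alpha /\ delta F alpha < 1].
Proof.
by split; [exact: uncountable_improvable | exact: improvable_negligible].
Qed.
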